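(* Let $k,n\in\mathbb{N}=\{1,2,3,\dots\}$. Let $(M,\omega)$ be a non-empty closed connected object of $\Omega^{kn,k}$ such that $\omega$ is maxipotent. Let $c$ be a capacity on some small weak $(kn,k)$-form category whose objects include all disjoint unions of two positively rescaled copies of $(M,\omega)$, i.e. $(M,a\omega)\sqcup(M,b\omega)$ for all $a,b\in(0,\infty)$, such that $c$ is finite on each such disjoint union. Then $c$ is not target-representable.
   Context: All manifolds are smooth, finite-dimensional, Hausdorff, second countable, and may have boundary and may be disconnected unless stated otherwise. ''Closed'' manifold means compact and without boundary. Universal form category: for $m,k\in\mathbb{N}_0$, $\Omega^{m,k}$ is the category whose objects are pairs $(M,\omega)$ with $M$ a manifold of dimension $m$ and $\omega$ a differential $k$-form on $M$; a morphism $(M,\omega)\to(M',\omega')$ is a smooth embedding $\varphi:M\to M'$ with $\varphi^*\omega'=\omega$ (no condition involving the boundaries is imposed). For $a\in(0,\infty)$ put $a(M,\omega):=(M,a\omega)$; this, together with sending each morphism to the same underlying map, gives an $\mathbb{R}^+=(0,\infty)$-action on $\Omega^{m,k}$. A small weak $(m,k)$-form category is a small $\mathbb{R}^+$-invariant subcategory of $\Omega^{m,k}$ (not necessarily full or isomorphism-closed). A capacity on such a category $\mathcal{C}$ with object set $\mathcal{O}$ is a map $c:\mathcal{O}\to[0,\infty]$ such that $c(A)\leq c(B)$ whenever there is a $\mathcal{C}$-morphism $A\to B$, and $c(aA)=a\,c(A)$ for all $A\in\mathcal{O}$, $a\in(0,\infty)$. For an object $X$ of $\Omega^{m,k}$,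 the target-embedding capacity is $c^X_{\mathcal{O},\Omega^{m,k}}:\mathcal{O}\to[0,\infty]$, $c^X(A):=\inf\{b\in(0,\infty)\mid\exists\ \Omega^{m,k}\text{-morphism } A\to bX\}$, with $\inf\emptyset=+\infty$. A capacity $c$ on $\mathcal{C}$ is target-representable iff there exists an object $(X,\Omega)$ of $\Omega^{m,k}$ with $c=c^{(X,\Omega)}_{\mathcal{O},\Omega^{m,k}}$. A $k$-form $\omega$ on a $kn$-dimensional manifold is maxipotent iff $\omega^{\wedge n}$ is nowhere-vanishing. *)

(* Defs.v *)
From HB Require Import structures.
From mathcomp Require Import all_boot all_order all_algebra all_fingroup.
From mathcomp Require Import all_classical all_reals all_analysis.
Set Implicit Arguments.
Unset Strict Implicit.
Unset Printing Implicit Defensive.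
Import Order.TTheory GRing.Theory Num.Theory numFieldNormedType.Exports.
Local Open Scope classical_set_scope.
Local Open Scope ring_scope.

(* The field of real numbers is an arbitrary [R : realType]. [Cn_on n U G]: on
   the open set [U], the map [G] is of class C^n. *)
Fixpoint Cn_on (R : realType) (m : nat) (V : normedModType R) (n : nat)
    (U : set 'rV[R]_m) (G : 'rV[R]_m -> V) : Prop :=
  match n with
  | 0 => {in U, continuous G}
  | n'.+1 => (forall x, U x -> differentiable G x) /\
             (forall v, Cn_on n' U (fun x => 'D_v G x))
  end.

Definition smooth_on (R : realType) (m : nat) (V : normedModType R)
    (U : set 'rV[R]_m) (G : 'rV[R]_m -> V) : Prop :=
  forall n, Cn_on n U G.

(* The first coordinate is nonnegative; this is a point when m = 0. *)
Definition half_space (R : realType) (m : nat) : set 'rV[R]_m :=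
  [set x | forall j : 'I_m, val j = 0%N -> 0 <= x 0 j].

(* [x] is a coordinate map on the open set [D]: a homeomorphism of [D] onto a
   relatively open subset of the half-space. Values outside [D] are junk. *)
Definition is_chart (R : realType) (m : nat) (T : topologicalType)
    (D : set T) (x : T -> 'rV[R]_m) : Prop :=
  [/\ open D,
      {in D, continuous x},
      {in D &, injective x} &
      forall U, open U -> U `<=` D ->
        exists2 W, open W & x @` U = W `&` @half_space R m].

(* Smoothness of [f] at [p] read in the coordinates [x]: the function
   f o x^-1, defined on an open piece of the half-space around [x p], is
   the restriction of a function that is smooth on an open set of R^m. *)
Definition smooth_at (R : realType) (m : nat) (V : normedModType R)
    (T : topologicalType) (x : T -> 'rV[R]_m) (p : T) (f : T -> V) : Prop :=
  exists U G, [/\ open_nbhs (x p) U, smooth_on U G &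
                  \forall q \near p, f q = G (x q)].

(* [J] is the derivative of f o x^-1 at [x p], one-sided at boundary points,
   acting on row vectors by right multiplication. *)
Definition is_jacobian (R : realType) (m : nat) (T : topologicalType)
    (x f : T -> 'rV[R]_m) (p : T) (J : 'M[R]_m) : Prop :=
  forall e : R, 0 < e ->
    \forall q \near p, `|f q - f p - (x q - x p) *m J| <= e * `|x q - x p|.

(* The atlas is an indexed family of charts and need not be maximal.
   The universe of [topologicalType] carriers is the universe of "sets": chart
   indices and the object sets of small categories live there as well. *)
Record manifold (R : realType) (m : nat) := Manifold {
  space :> topologicalType;
  chart : Type@{Topological.axioms_.u0};
  dom : chart -> set space;
  coord : chart -> space -> 'rV[R]_m;
  space_hausdorff : hausdorff_space space;
  space_second_countable : @second_countable space;
  coord_chart : forall i, is_chart (dom i) (coord i);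
  dom_cover : forall p, exists i, dom i p;
  coord_smooth : forall i j p, dom i p -> dom j p ->
    smooth_at (coord i) p (coord j) }.

Arguments dom {R m M} : rename.
Arguments coord {R m M} : rename.

Definition boundary (R : realType) (m : nat) (M : manifold R m) : set M :=
  [set p | exists i (j : 'I_m), [/\ dom i p, val j = 0%N & coord i p 0 j = 0]].

Definition closed_manifold (R : realType) (m : nat) (M : manifold R m) : Prop :=
  compact [set: M] /\ @boundary R m M = set0.

Definition smooth_map (R : realType) (m : nat) (M N : manifold R m)
    (f : M -> N) : Prop :=
  continuous f /\
  forall i j p, dom i p -> dom j (f p) ->
    smooth_at (coord i) p (coord j \o f).

(* [row_free J] says that v |-> v *m J, the differential in coordinates, is
   injective. *)
Definition immersion (R : realType) (m : nat) (M N : manifold R m)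
    (f : M -> N) : Prop :=
  smooth_map f /\
  forall i j p J, dom i p -> dom j (f p) ->
    is_jacobian (coord i) (coord j \o f) p J -> row_free J.

Definition smooth_embedding (R : realType) (m : nat) (M N : manifold R m)
    (f : M -> N) : Prop :=
  [/\ immersion f, injective f &
      forall U : set M, open U -> exists2 W : set N, open W & U = f @^-1` W].

(* The k arguments in R^m of a k-linear form are the rows of a k x m matrix;
   the two conditions have the shape of [determinant_multilinear] and
   [determinant_alternate]. *)
Definition alternating (R : realType) (k m : nat) (u : 'M[R]_(k, m) -> R) :=
  (forall (A B C : 'M[R]_(k, m)) (i : 'I_k) (b c : R),
     row i A = b *: row i B + c *: row i C ->
     row' i B = row' i A -> row' i C = row' i A ->
     u A = b * u B + c * u C) /\
  (forall (A : 'M[R]_(k, m)) (i j : 'I_k),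
     i != j -> A i =1 A j -> u A = 0).

(* (u /\ v)(a_1, ..., a_{k+l}) is the sum over permutations s, divided by k! l!,
   of sgn(s) u(a_{s 1}, ..., a_{s k}) v(a_{s(k+1)}, ..., a_{s(k+l)}). *)
Definition wedge (R : realType) (k l m : nat)
    (u : 'M[R]_(k, m) -> R) (v : 'M[R]_(l, m) -> R) : 'M[R]_(k + l, m) -> R :=
  fun A => (k`! * l`!)%:R^-1 *
    \sum_(s : 'S_(k + l))
      (-1) ^+ s * u (usubmx (row_perm s A)) * v (dsubmx (row_perm s A)).

Fixpoint wedge_pow (R : realType) (k m : nat) (n : nat)
    (u : 'M[R]_(k, m) -> R) : 'M[R]_(n * k, m) -> R :=
  match n with
  | 0 => fun=> 1
  | n'.+1 => wedge u (@wedge_pow R k m n' u)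
  end.
Arguments wedge_pow {R k m} n u.

(* A k-form on M is given at each point p by its expressions in the charts i
   around p, i.e. by an alternating form [coef i p] on the tangent space T_p M
   identified with R^m through the chart i. The values outside the chart
   domains are normalised to 0, so that a form determines its expressions. *)
Record diff_form (R : realType) (m k : nat) (M : manifold R m) := DiffForm {
  coef : chart M -> M -> 'M[R]_(k, m) -> R;
  coef_alt : forall i p, alternating (coef i p);
  coef_out : forall i p A, ~ dom i p -> coef i p A = 0;
  coef_smooth : forall i p A, dom i p ->
    smooth_at (coord i) p (fun q => coef i q A : R^o);
  coef_change : forall i j p J A, dom i p -> dom j p ->
    is_jacobian (coord i) (coord j) p J -> coef i p A = coef j p (A *m J) }.

Record form_obj (R : realType) (m k : nat) := FormObj {
  obj_manifold :> manifold R m;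
  obj_form : diff_form k obj_manifold }.

Definition pullback_eq (R : realType) (m k : nat) (M N : manifold R m)
    (f : M -> N) (w' : diff_form k N) (w : diff_form k M) : Prop :=
  forall i j p J A, dom i p -> dom j (f p) ->
    is_jacobian (coord i) (coord j \o f) p J ->
    coef w' j (f p) (A *m J) = coef w i p A.

Definition form_mor (R : realType) (m k : nat) (X Y : form_obj R m k)
    (f : X -> Y) : Prop :=
  smooth_embedding f /\ pullback_eq f (obj_form Y) (obj_form X).
Arguments form_mor {R m k} X Y f.

Definition maxipotent (R : realType) (k n : nat) (M : manifold R (k * n))
    (w : diff_form k M) : Prop :=
  forall i p, dom i p -> exists A, wedge_pow n (coef w i p) A != 0.
Arguments maxipotent {R k} n {M} w.

Section Scale.
Variable R : realType.

Lemma deriveZ_total (V : normedModType R) (G : V -> R^o) (a : R) (v x : V) :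
  'D_v (a \*: G) x = a *: 'D_v G x.
Proof.
have [dG|ndG] := pselect (derivable G x v); first exact: deriveZ.
have [->|a0] := eqVneq a 0.
  by rewrite scale0r (_ : 0 \*: G = cst 0) ?derive_cst// funeqE => y /=; rewrite scale0r.
rewrite /derive [in RHS]dvgP// dvgP; first by rewrite -[LHS]/(0 : R^o) -[point]/(0 : R^o) scaler0.
move=> daG; apply: ndG.
rewrite (_ : G = a^-1 \*: (a \*: G)); first exact: derivableZ.
by rewrite funeqE => y /=; rewrite scalerA mulVf// scale1r.
Qed.

Lemma Cn_on_scale m n (U : set 'rV[R]_m)
    (G : 'rV[R]_m -> R^o) (a : R) : Cn_on n U G -> Cn_on n U (a \*: G).
Proof.
elim: n G => [|n IHn] G /=.
  by move=> cG x Ux; have Gx := cG x Ux; exact: cvgZl_tmp Gx.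
move=> [dG DG]; split=> [x Ux|v].
  exact: (@differentiableZ _ _ _ G a x (dG x Ux)).
rewrite (_ : (fun x => _) = a \*: (fun x => 'D_v G x)); first exact/IHn/DG.
by rewrite funeqE => x; exact: deriveZ_total.
Qed.

Variables (m k : nat) (a : R).

Lemma smooth_at_scale (T : topologicalType)
    (x : T -> 'rV[R]_m) (p : T) (f : T -> R^o) :
  smooth_at x p f -> smooth_at x p (a \*: f).
Proof.
move=> [U [G [Up sG fG]]]; exists U, (a \*: G); split => //.
- by move=> n; exact: Cn_on_scale.
- by near=> q => /=; congr (_ *: _); near: q.
Unshelve. all: by end_near. Qed.

Lemma alternating_scale (u : 'M[R]_(k, m) -> R) :
  alternating u -> alternating (fun A => a * u A).
Proof.
move=> [uL uA]; split=> [A B C i b c hA hB hC|A i j ij Aij].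
  by rewrite (uL A B C i b c)// mulrDr !(mulrCA a).
by rewrite (uA A i j)// mulr0.
Qed.

Program Definition scale_form (M : manifold R m) (w : diff_form k M) :
    diff_form k M :=
  @DiffForm R m k M (fun i p A => a * coef w i p A) _ _ _ _.
Next Obligation. by move=> *; exact/alternating_scale/coef_alt. Qed.
Next Obligation. by move=> M w i p A ip /=; rewrite coef_out ?mulr0. Qed.
Next Obligation.
by move=> M w i p A ip; exact/smooth_at_scale/coef_smooth.
Qed.
Next Obligation.
by move=> M w i j p J A ip jp xJ /=; rewrite (coef_change w _ ip jp xJ).
Qed.

Definition scale (X : form_obj R m k) : form_obj R m k :=
  FormObj (scale_form (obj_form X)).

End Scale.

Section DisjointUnion.
Variables (R : realType) (m k : nat).

Section Family.
Variables (I : choiceType) (T : I -> topologicalType).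
Local Notation S := {b : I & T b}.

Lemma untagT (V : Type) (v : V) b (f : T b -> V) (p : T b) :
  untag v f (existT _ b p : S) = f p.
Proof. exact: (untagE _ _ (erefl b : tag (existT _ b p : S) = b)). Qed.

Lemma near_existT b (p : T b) (P : set S) :
  (\forall q \near p, P (existT _ b q)) -> \forall q \near (existT _ b p : S), P q.
Proof. by []. Qed.

Lemma existT_near b (p : T b) (P : set S) :
  (\forall q \near (existT _ b p : S), P q) -> \forall q \near p, P (existT _ b q).
Proof. by []. Qed.

Lemma is_chart_untag b (D : set (T b)) (x : T b -> 'rV[R]_m) :
  is_chart D x -> is_chart (existT _ b @` D : set S) (untag 0 x).
Proof.
move=> [oD cx ix hx]; split.
- exact: existT_open_map oD.
- move=> _ /set_mem[p Dp <-] A; rewrite /= untagT => xA.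
  have xAp : \forall q \near p, A (x q) := cx p (mem_set Dp) A xA.
  by apply: near_existT; apply: filterS xAp => q; rewrite /= untagT.
- move=> _ _ /set_mem[p Dp <-] /set_mem[q Dq <-]; rewrite !untagT => xpq.
  by rewrite (ix p q) ?inE.
- move=> U oU UD; have [|q Uq|W oW xW] := hx (existT _ b @^-1` U).
  + by move/sigT_openP : oU; exact.
  + by have [q' Dq' e] := UD _ Uq; rewrite -(existT_inj2 e).
  + exists W => //; rewrite -xW; apply/seteqP; split=> [_ [p Up <-]|_ [q Uq <-]].
      by have [q Dq qp] := UD _ Up; rewrite -qp in Up *; exists q => //; rewrite untagT.
    by exists (existT _ b q) => //; rewrite untagT.
Qed.

Lemma smooth_at_untag (V : normedModType R) b (x : T b -> 'rV[R]_m)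
    (f : T b -> V) (g : S -> V) (p : T b) :
  (forall q, g (existT _ b q) = f q) ->
  smooth_at x p f -> smooth_at (untag 0 x) (existT _ b p : S) g.
Proof.
move=> gf [U [G [Up sG fG]]]; exists U, G; split => //; first by rewrite untagT.
by apply: near_existT; apply: filterS fG => q; rewrite untagT gf.
Qed.

Lemma untag_jacobian b (x f : T b -> 'rV[R]_m) (p : T b) J :
  is_jacobian (untag 0 x) (untag 0 f) (existT _ b p : S) J -> is_jacobian x f p J.
Proof.
move=> xJ e e0; apply: filterS (existT_near (xJ e e0)) => q.
by rewrite /= !untagT.
Qed.

Lemma sigT_second_countable : countable [set: I] ->
  (forall b, @second_countable (T b)) -> @second_countable S.
Proof.
move=> cI sc.
pose B0 b := s2val (cid2 (sc b)).
have scB b : countable (B0 b) /\ basis (B0 b) by split; rewrite /B0; case: cid2.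
exists (\bigcup_b ((fun U => existT _ b @` U) @` B0 b)).
  apply: bigcup_countable => // b _; have [cB _] := scB b.
  exact: sub_countable (card_image_le _ _) cB.
split=> [_ [b _ [U BU <-]]|[b p] A].
  by apply: existT_open_map; have [_ [+ _]] := scB b; exact.
move=> pA; have [_ [_ /(_ p _ pA)[U [BU Up] UA]]] := scB b.
exists (existT _ b @` U); last by move=> _ [q Uq <-]; exact: UA.
by split; [exists b => //; exists U | exists p].
Qed.

End Family.

Variable I : countType.

Program Definition sum_manifold (M : I -> manifold R m) : manifold R m :=
  @Manifold R m {b : I & M b} {b : I & chart (M b)}
    (fun u => existT _ (tag u) @` dom (tagged u))
    (fun u => untag 0 (coord (tagged u))) _ _ _ _ _.
Next Obligation. by move=> M; apply: sigT_hausdorff => b; exact: space_hausdorff. Qed.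
Next Obligation.
move=> M; apply: sigT_second_countable => [|b]; first exact: countableP.
exact: space_second_countable.
Qed.
Next Obligation. by move=> M [b i]; exact/is_chart_untag/coord_chart. Qed.
Next Obligation.
move=> M [b p]; have [i ip] := dom_cover p.
by exists (existT _ b i), p.
Qed.
Next Obligation.
move=> M [b i] [c j] _ /= [p ip <-] [q jq bc].
have cb : c = b by have := congr1 tag bc.
move: cb j q jq bc => -> j q jq bc; rewrite (existT_inj2 bc) in jq.
apply: smooth_at_untag (coord_smooth ip jq) => q'.
by rewrite untagT.
Qed.

Program Definition sum_form (M : I -> manifold R m)
    (w : forall b, diff_form k (M b)) : diff_form k (sum_manifold M) :=
  @DiffForm R m k (sum_manifold M)
    (fun u p A => untag 0 (fun q => coef (w (tag u)) (tagged u) q A) p) _ _ _ _.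
Next Obligation.
move=> M w [b i] [c p]; have [cb|cb] := eqVneq c b.
  move: cb p => -> p; split=> [A B C r x y hA hB hC|A r s rs Ars] /=.
    by rewrite !untagT; have [+ _] := coef_alt (w b) i p; apply; eassumption.
  by rewrite !untagT; have [_ +] := coef_alt (w b) i p; apply; eassumption.
split=> [A B C r x y hA hB hC|A r s rs Ars] /=.
  by rewrite !untag_dflt// !mulr0 addr0.
by rewrite untag_dflt.
Qed.
Next Obligation.
move=> M w [b i] [c p] A /= np; have [cb|cb] := eqVneq c b; last exact: untag_dflt.
move: cb p np => -> p np; rewrite untagT coef_out// => ip.
by apply: np; exists p.
Qed.
Next Obligation.
move=> M w [b i] _ A /= [p ip <-].
apply: (smooth_at_untag (V := R^o)) (coef_smooth (w b) A ip) => q.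
by rewrite untagT.
Qed.
Next Obligation.
move=> M w [b i] [c j] _ J A /= [p ip <-] [q jq bc].
have cb : c = b by have := congr1 tag bc.
move: cb j q jq bc => -> j q jq bc xJ; rewrite (existT_inj2 bc) in jq.
rewrite !untagT; apply: coef_change => //; exact: untag_jacobian xJ.
Qed.

End DisjointUnion.

Definition disjoint_union (R : realType) (m k : nat) (X Y : form_obj R m k) :
    form_obj R m k :=
  let Z (b : bool) := if b then Y else X in
  FormObj (sum_form (fun b => obj_form (Z b))).

Record weak_form_category (R : realType) (m k : nat) := WeakFormCategory {
  objs : form_obj R m k -> Prop;
  homs : forall X Y : form_obj R m k, (X -> Y) -> Prop;
  homs_sub : forall X Y f, @homs X Y f -> [/\ objs X, objs Y & form_mor X Y f];
  homs_id : forall X, objs X -> @homs X X id;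
  homs_comp : forall X Y Z f g, @homs X Y f -> @homs Y Z g -> @homs X Z (g \o f);
  objs_scale : forall a X, 0 < a -> objs X -> objs (scale a X);
  homs_scale : forall a X Y f, 0 < a ->
    @homs X Y f -> @homs (scale a X) (scale a Y) f;
  objs_small : exists (J : Type@{Topological.axioms_.u0})
    (F : J -> form_obj R m k), forall X, objs X -> exists x, F x = X }.

Arguments homs {R m k} C X Y f : rename.

Local Open Scope ereal_scope.

(* Capacities are functions on the objects of C; only the values of c there
   are ever used. *)
Definition is_capacity (R : realType) (m k : nat) (C : weak_form_category R m k)
    (c : form_obj R m k -> \bar R) : Prop :=
  [/\ forall X, objs C X -> 0 <= c X,
      forall X Y f, homs C X Y f -> c X <= c Y &
      forall a X, (0 < a)%R -> objs C X -> c (scale a X) = a%:E * c X].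

Definition target_capacity (R : realType) (m k : nat) (X : form_obj R m k)
    (A : form_obj R m k) : \bar R :=
  ereal_inf [set b%:E | b in
    [set b : R | (0 < b)%R /\ exists f, form_mor A (scale b X) f]].

Definition target_representable (R : realType) (m k : nat)
    (C : weak_form_category R m k) (c : form_obj R m k -> \bar R) : Prop :=
  exists X, forall A, objs C A -> c A = target_capacity X A.

(* Main.v *)
Require Import Defs.
From HB Require Import structures.
From mathcomp Require Import all_boot all_order all_algebra all_fingroup.
From mathcomp Require Import all_classical all_reals all_analysis.
From mathcomp Require Import ring lra.
Set Implicit Arguments.
Unset Strict Implicit.
Unset Printing Implicit Defensive.
Import Order.TTheory GRing.Theory Num.Theory numFieldNormedType.Exports.
Local Open Scope classical_set_scope.
Local Open Scope ring_scope.

(* If [c] is represented by [X], every union of two rescaled copies of [M]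
   embeds into a rescaling of [X], so every positive real is a ratio [s / s'] of
   reals for which [s M] embeds into [X]. Images of such embeddings are open
   (inverse function theorem) and compact, hence connected components of [X].
   If two embeddings with [s < s'] had the same image, the transition map
   [phi : M -> M] would multiply the volume form of [M] by [(s / s') ^ n < 1].
   Its iterates then multiply volumes by arbitrarily small factors, which is
   impossible for surjections of a compact manifold. Hence distinct [s] give
   disjoint components, there are countably many of them, and the positive reals
   would be countable.

   No integration is needed: since the factor can be made arbitrarily small, it
   is enough to measure volumes up to constants, by finite covers by boxes. *)

Local Notation dom := Defs.dom.
Local Notation coord := Defs.coord.

(** * Top-degree forms *)

Section TopForms.
Variable R : realType.

(** Stated by entries, so that after permuting the rows and splitting the matrix the hypotheses can
    be checked index by index. *)
Definition row_multilinear p m (F : 'M[R]_(p, m) -> R) :=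
  forall (A B C : 'M[R]_(p, m)) i b c,
    (forall j, A i j = b * B i j + c * C i j) ->
    (forall i' j, i' != i -> B i' j = A i' j) ->
    (forall i' j, i' != i -> C i' j = A i' j) ->
    F A = b * F B + c * F C.

Definition row_antisymmetric p m (F : 'M[R]_(p, m) -> R) :=
  forall (s : 'S_p) A, F (row_perm s A) = (-1) ^+ s * F A.

Lemma alternating_multilinear p m (F : 'M[R]_(p, m) -> R) :
  Defs.alternating F -> row_multilinear F.
Proof.
move=> [FL _] A B C i b c hA hB hC; apply: (FL A B C i).
- by apply/rowP => j; rewrite !mxE hA.
- by apply/matrixP => i' j; rewrite !mxE hB// eq_sym neq_lift.
- by apply/matrixP => i' j; rewrite !mxE hC// eq_sym neq_lift.
Qed.

(** In the term of [s], row [i] lands in position [j] with [s j = i], hence in the block of [u] or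
    in that of [v]. The term is linear through that factor, and the other factor does not see row
    [i]. *)
Lemma wedge_multilinear k l m (u : 'M[R]_(k, m) -> R) (v : 'M[R]_(l, m) -> R) :
  row_multilinear u -> row_multilinear v -> row_multilinear (wedge u v).
Proof.
move=> uL vL A B C i b c hA hB hC; rewrite /wedge.
have distl (e x y z : R) : e * (b * x + c * y) * z = b * (e * x * z) + c * (e * y * z).
  by ring.
have distr (e x y z : R) : e * z * (b * x + c * y) = b * (e * z * x) + c * (e * z * y).
  by ring.
rewrite [b * _]mulrCA [c * _]mulrCA -mulrDr; congr (_ * _).
rewrite !mulr_sumr -big_split; apply: eq_bigr => s _ /=.
have [j sj] : exists j, s j = i by exists (s^-1%g i); rewrite permKV.
have other j' : j' != j -> s j' != i.
  by apply: contra_neq => sj'; apply: (@perm_inj _ s); rewrite sj.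
case: (split_ordP j) => j0 jE.
- have -> : dsubmx (row_perm s A) = dsubmx (row_perm s B).
    by apply/matrixP => x y; rewrite !mxE hB// other// jE eq_rlshift.
  have -> : dsubmx (row_perm s C) = dsubmx (row_perm s B).
    by apply/matrixP => x y; rewrite !mxE hB ?hC// other// jE eq_rlshift.
  have -> : u (usubmx (row_perm s A)) =
      b * u (usubmx (row_perm s B)) + c * u (usubmx (row_perm s C)); last first.
    by rewrite distl.
  apply: (uL _ _ _ j0).
  + by move=> y; rewrite !mxE -jE sj.
  + by move=> x y xj; rewrite !mxE hB// other// jE eq_lshift.
  + by move=> x y xj; rewrite !mxE hC// other// jE eq_lshift.
- have -> : usubmx (row_perm s A) = usubmx (row_perm s B).
    by apply/matrixP => x y; rewrite !mxE hB// other// jE eq_lrshift.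
  have -> : usubmx (row_perm s C) = usubmx (row_perm s B).
    by apply/matrixP => x y; rewrite !mxE hB ?hC// other// jE eq_lrshift.
  have -> : v (dsubmx (row_perm s A)) =
      b * v (dsubmx (row_perm s B)) + c * v (dsubmx (row_perm s C)); last first.
    by rewrite distr.
  apply: (vL _ _ _ j0).
  + by move=> y; rewrite !mxE -jE sj.
  + by move=> x y xj; rewrite !mxE hB// other// jE eq_rshift.
  + by move=> x y xj; rewrite !mxE hC// other// jE eq_rshift.
Qed.

Lemma wedge_antisymmetric k l m (u : 'M[R]_(k, m) -> R) (v : 'M[R]_(l, m) -> R) :
  row_antisymmetric (wedge u v).
Proof.
move=> t A; rewrite /wedge mulrCA; congr (_ * _); rewrite mulr_sumr.
rewrite [RHS](reindex_inj (@mulIg _ t)) /=; apply: eq_bigr => s _.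
by rewrite -row_permM odd_permM signr_addb !mulrA (mulrC (_ ^+ t)) -!mulrA signrMK.
Qed.

Lemma wedge_pow_multilinear k m n (u : 'M[R]_(k, m) -> R) :
  row_multilinear u -> row_multilinear (wedge_pow n u).
Proof.
move=> uL; elim: n => [|n IHn] /=; last exact: wedge_multilinear.
by move=> A B C [].
Qed.

Lemma wedge_pow_antisymmetric k m n (u : 'M[R]_(k, m) -> R) :
  row_antisymmetric (wedge_pow n.+1 u).
Proof. exact: wedge_antisymmetric. Qed.

Lemma row_antisymmetric_eq_rows p m (F : 'M[R]_(p, m) -> R) (A : 'M[R]_(p, m)) i j :
  row_antisymmetric F -> i != j -> (forall l, A i l = A j l) -> F A = 0.
Proof.
move=> Fa ij Aij; have := Fa (tperm i j) A; rewrite odd_tperm ij expr1.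
have -> : row_perm (tperm i j) A = A.
  by apply/matrixP => x y; rewrite mxE; case: tpermP => [->|->|//].
lra.
Qed.

(* In the proof, [p] is the number of rows that remain to be expanded in the
   standard basis. *)
Lemma multilinear_basis_eq0 m (F : 'M[R]_m -> R) : row_multilinear F ->
  (forall g : 'I_m -> 'I_m, F (\matrix_(i, j) (g i == j)%:R) = 0) ->
  forall A, F A = 0.
Proof.
move=> FL F0.
suff FA p : (p <= m)%N -> forall A : 'M[R]_m,
    (forall i : 'I_m, (p <= i)%N -> exists g, forall j, A i j = (g == j)%:R) ->
    F A = 0.
  by move=> A; apply: (FA m) => // i; rewrite leqNgt ltn_ord.
elim: p => [_ A A0|p IHp pm A Ap].
  have [g Ag] := choice (fun i => A0 i isT).
  rewrite -(F0 g); congr F; apply/matrixP => i j; by rewrite mxE Ag.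
pose i0 := Ordinal pm.
(* [s] lists the columns where row [i0] may be nonzero. Column [j0] is split off: [B1] has a basis
   vector as row [i0] and falls under [IHp]; [B2] has that entry cleared and falls under [IHs]. For
   empty [s] the row is zero, and linearity with zero coefficients gives 0. *)
have reduce (s : seq 'I_m) : forall A : 'M[R]_m,
    (forall i : 'I_m, (p < i)%N -> exists g, forall j, A i j = (g == j)%:R) ->
    (forall j, j \notin s -> A i0 j = 0) -> F A = 0.
  elim: s => [|j0 s IHs] B Bp Bs.
    have := FL B B B i0 0 0; rewrite !mul0r addr0; apply => // j.
    by rewrite !mul0r addr0 Bs.
  pose B1 := \matrix_(i, j) (if i == i0 then (j0 == j)%:R else B i j).
  pose B2 := \matrix_(i, j) (if i == i0 then if j == j0 then 0 else B i j else B i j).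
  rewrite (FL B B1 B2 i0 (B i0 j0) 1).
  - rewrite IHp ?IHs ?mulr0 ?addr0//.
    + move=> i pi; have [g gP] := Bp _ pi; exists g => j; rewrite !mxE ifN//.
      by apply: contraTneq pi => ->; rewrite ltnn.
    + move=> j js; rewrite !mxE eqxx; case: eqVneq => // jj0; apply: Bs.
      by rewrite inE negb_or jj0.
    + exact: ltnW.
    + move=> i; rewrite leq_eqVlt => /predU1P[pi|pi].
        exists j0 => j; rewrite !mxE ifT//; exact/eqP/val_inj.
      have [g gP] := Bp _ pi; exists g => j; rewrite !mxE ifN//.
      by apply: contraTneq pi => ->; rewrite ltnn.
  - by move=> j; rewrite !mxE eqxx (eq_sym j0); case: eqVneq => [->|_] /=; ring.
  - by move=> i j /negPf ii0; rewrite mxE ii0.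
  - by move=> i j /negPf ii0; rewrite mxE ii0.
by apply: (reduce (enum 'I_m)) => // j; rewrite mem_enum.
Qed.

(** The difference of the two sides, [H], is multilinear and antisymmetric, so rows from the
    standard basis suffice. Distinct basis rows form a permuted identity, where [H] vanishes as it
    does at 1; repeated rows give 0 by antisymmetry. *)
Lemma top_form_det m (F : 'M[R]_m -> R) A :
  row_multilinear F -> row_antisymmetric F -> F A = F 1%:M * \det A.
Proof.
move=> FL Fa; apply/eqP; rewrite -subr_eq0; apply/eqP.
pose H A := F A - F 1%:M * \det A.
have Ha : row_antisymmetric H.
  by move=> s B; rewrite /H Fa row_permE det_mulmx det_perm mulrBr (mulrCA (F _)).
rewrite -/(H A); move: A; apply: multilinear_basis_eq0 => [A B C i b c hA hB hC|g].
  rewrite /H (FL A B C i b c)//.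
  rewrite (@determinant_multilinear _ _ A B C i b c).
  - by rewrite mulrDr (mulrCA _ b) (mulrCA _ c) !mulrBr opprD addrACA.
  - by apply/rowP => j; rewrite !mxE hA.
  - by apply/matrixP => i' j; rewrite !mxE hB// eq_sym neq_lift.
  - by apply/matrixP => i' j; rewrite !mxE hC// eq_sym neq_lift.
have [/injectiveP gI|/injectivePn[i [j ij gij]]] := boolP (injectiveb g).
  have -> : \matrix_(i, j) (g i == j)%:R = row_perm (perm gI) 1%:M :> 'M[R]_m.
    by apply/matrixP => i j; rewrite !mxE permE.
  by rewrite Ha /H det1 mulr1 subrr mulr0.
by apply: (row_antisymmetric_eq_rows Ha ij) => l; rewrite !mxE gij.
Qed.

(** The equation [p = m] accommodates [wedge_pow n], whose arguments have [n * k] rows and [k * n]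
    columns. *)
Lemma top_form_mulmx p m (F : 'M[R]_(p, m) -> R) (A : 'M[R]_(p, m)) (J : 'M[R]_m) :
  p = m -> row_multilinear F -> row_antisymmetric F ->
  F (A *m J) = \det J * F A.
Proof.
move=> pm; case: m / pm F A J => F A J FL Fa.
by rewrite (top_form_det (A *m J))// (top_form_det A)// det_mulmx mulrA [LHS]mulrC.
Qed.

Lemma top_form_neq0 p m (F : 'M[R]_(p, m) -> R) (e : p = m) A :
  row_multilinear F -> row_antisymmetric F -> F A != 0 ->
  F (castmx (erefl, e) 1%:M) != 0.
Proof.
case: m / e F A => F A FL Fa; rewrite castmx_id (top_form_det A)//.
by rewrite mulf_eq0 negb_or => /andP[].
Qed.

Lemma wedge_pow_mulmx k m n (u v : 'M[R]_(k, m) -> R) (J : 'M[R]_m) :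
  (forall A, u (A *m J) = v A) ->
  forall A, wedge_pow n u (A *m J) = wedge_pow n v A.
Proof.
move=> uv; elim: n => [//|n IHn] A /=; rewrite /wedge; congr (_ * _).
apply: eq_bigr => s _; rewrite !row_permE mulmxA.
by rewrite -IHn -uv mul_usub_mx mul_dsub_mx.
Qed.

Lemma wedge_pow_scale k m n (u : 'M[R]_(k, m) -> R) s A :
  wedge_pow n (fun A => s * u A) A = s ^+ n * wedge_pow n u A.
Proof.
elim: n A => [A|n IHn A] /=; first by rewrite mul1r.
rewrite /wedge mulrCA; congr (_ * _); rewrite mulr_sumr.
by apply: eq_bigr => t _; rewrite IHn exprS -!mulrA !(mulrCA s)
  (mulrCA _ (s ^+ n)) (mulrCA _ (s ^+ n)).
Qed.

End TopForms.

(** * Counting grid points *)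

Section RowNorm.
Variables (R : realType) (m : nat).
Implicit Types (v : 'rV[R]_m) (e : R).

Lemma row_norm_leP v e : 0 <= e -> `|v| <= e <-> forall j, `|v 0 j| <= e.
Proof.
move=> e0; rewrite -[`|v|]/(mx_norm v) mx_normrE; split=> [/bigmax_leP[_ ve] j|ve].
  exact: (ve (0, j)).
by apply/bigmax_leP; split=> // -[i j] _; rewrite (ord1 i).
Qed.

Lemma row_norm_ltP v e : 0 < e -> `|v| < e <-> forall j, `|v 0 j| < e.
Proof.
move=> e0; rewrite -[`|v|]/(mx_norm v) mx_normrE; split=> [/bigmax_ltP[_ ve] j|ve].
  exact: (ve (0, j)).
by apply/bigmax_ltP; split=> // -[i j] _; rewrite (ord1 i).
Qed.

Lemma mulmx_norm_bound p (J : 'M[R]_(m, p)) :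
  exists2 B, 0 < B & forall v, `|v *m J| <= B * `|v|.
Proof.
exists (1 + \sum_i \sum_j `|J i j|).
  by rewrite ltr_pwDl// sumr_ge0// => i _; rewrite sumr_ge0.
move=> v.
have S0 : 0 <= \sum_i \sum_j `|J i j| by rewrite sumr_ge0// => i _; rewrite sumr_ge0.
have B0 : 0 <= (1 + \sum_i \sum_j `|J i j|) * `|v|.
  by rewrite mulr_ge0// addr_ge0.
rewrite -[`|_ *m _|]/(mx_norm (v *m J)) mx_normrE; apply/bigmax_leP; split=> // -[i j] _.
rewrite /= ord1 mxE (le_trans (ler_norm_sum _ _ _))//.
have vl l : `|v 0 l| <= `|v| by move: l; apply/row_norm_leP.
apply: (@le_trans _ _ (\sum_l `|v| * `|J l j|)).
  by apply: ler_sum => l _; rewrite normrM ler_wpM2r.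
rewrite -mulr_sumr mulrC ler_wpM2r//.
apply: (@le_trans _ _ (\sum_l \sum_j `|J l j|)); last by rewrite lerDr.
by apply: ler_sum => l _; rewrite (bigD1 j)//= lerDl sumr_ge0.
Qed.

End RowNorm.

Section Counting.

(** This bound and the next, applied to sets of grid points, play the roles of subadditivity and
    additivity of volume. *)
Lemma card_le_cover (T : finType) (I : eqType) (s : seq I) (P : I -> pred T) :
  (forall x, exists2 i, i \in s & P i x) -> (#|T| <= \sum_(i <- s) #|P i|)%N.
Proof.
move=> sP; rewrite -sum1_card.
rewrite [leqRHS](eq_bigr (fun i => \sum_x P i x)%N); last first.
  by move=> i _; rewrite -sum1_card big_mkcond; apply: eq_bigr => x _;
     rewrite unfold_in; case: (P i x).
rewrite exchange_big; apply: leq_sum => x _ /=.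
by have [i si Pix] := sP x; rewrite (big_rem i)//= Pix.
Qed.

Lemma card_ge_disjoint (T : finType) (I : eqType) (s : seq I) (P : I -> pred T) :
  pairwise (fun i j => [forall x, ~~ (P i x && P j x)]) s -> (\sum_(i <- s) #|P i| <= #|T|)%N.
Proof.
move=> sP; rewrite -sum1_card.
rewrite (eq_bigr (fun i => \sum_x P i x)%N); last first.
  by move=> i _; rewrite -sum1_card big_mkcond; apply: eq_bigr => x _;
     rewrite unfold_in; case: (P i x).
rewrite exchange_big; apply: leq_sum => x _ /=.
elim: s sP => [|i s IHs]/=; first by rewrite big_nil.
move=> /andP[is_ /IHs]; rewrite big_cons; case Pix : (P i x) => //= _.
rewrite big1_seq// => j /= js; apply/eqP; rewrite eqb0; apply/negP => Pjx.
move/(all_nthP j): is_ => /(_ (index j s)).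
rewrite index_mem nth_index// => /(_ js)/forallP/(_ x).
by rewrite Pix Pjx.
Qed.

Variable R : realType.

(** An interval of length [d] contains at most [truncn d + 1] integers, and [d + 1 <= 2 * d]. *)
Lemma card_grid_le N (P : pred 'I_N) (lo d : R) : 1 <= d ->
  (forall p, P p -> lo <= p%:R <= lo + d) -> #|P|%:R <= 2 * d.
Proof.
move=> d1 hP.
have [/existsP[q0 Pq0]|P0] := boolP [exists q, P q]; last first.
  rewrite eq_card0 ?mulr_ge0//; first lra.
  by move=> q; apply/negP => Pq; case/negP: P0; apply/existsP; exists q.
case: (@arg_minnP _ q0 P val Pq0) => /= q Pq qmin.
have d0 : 0 <= d by lra.
suff : (#|P| <= (Num.truncn d).+1)%N.
  rewrite -(ler_nat R) -natr1 => /le_trans; apply.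
  by have := truncn_le d; rewrite d0 => td; rewrite mulrDl !mul1r lerD.
rewrite cardE -(size_map val) -(size_iota q (Num.truncn d).+1).
apply: uniq_leq_size; first by rewrite map_inj_uniq ?enum_uniq//; exact: val_inj.
move=> x /mapP[p]; rewrite mem_enum => Pp {x}->; rewrite mem_iota (qmin _ Pp)/=.
rewrite addnS ltnS -leq_subLR truncn_ge_nat//.
rewrite natrB ?qmin//; have := hP _ Pp; have := hP _ Pq; lra.
Qed.

(** The first [truncn d] integers above [u - d] lie in the open interval and below [N]; since
    [2 <= d], their number exceeds [d - 1 >= d / 2]. *)
Lemma card_grid_ge N (u d : R) : 2 <= d -> 0 <= u - d -> u + d <= N%:R ->
  d / 2 <= #|[pred p : 'I_N | `|p%:R - u| < d]|%:R.
Proof.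
move=> d2 ud uN; have d0 : 0 <= d by lra.
have /andP[t1 t2] := truncn_itv d0; rewrite -natr1 in t2.
apply: (@le_trans _ _ (Num.truncn d)%:R); first by lra.
rewrite ler_nat cardE -(size_map val) -[leqLHS](size_iota (Num.truncn (u - d)).+1).
apply: uniq_leq_size; first exact: iota_uniq.
have /andP[s1 s2] := truncn_itv ud; rewrite -natr1 in s2.
move=> p; rewrite mem_iota => /andP[p1 p2].
have {}p1 : (Num.truncn (u - d))%:R + 1 <= p%:R :> R by rewrite natr1 ler_nat.
have {}p2 : p%:R + 1 <= (Num.truncn (u - d))%:R + 1 + (Num.truncn d)%:R :> R.
  by rewrite !natr1 -natrD ler_nat.
have pN : (p < N)%N by rewrite -(ltr_nat R); lra.
apply/mapP; exists (Ordinal pN) => //; rewrite mem_enum inE /= ltr_norml.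
by apply/andP; split; lra.
Qed.

Lemma card_fun_family m N (P : 'I_m -> pred 'I_N) :
  #|[pred p : {ffun 'I_m -> 'I_N} | [forall j, P j (p j)]]| = (\prod_j #|P j|)%N.
Proof.
rewrite -[LHS]/#|family P|.
by rewrite card_family foldrE big_image.
Qed.

End Counting.

(** * Volume of finite unions of boxes *)

Section Covering.
Variables (R : realType) (m : nat).
Implicit Types (E F : set 'rV[R]_m) (v w c x : 'rV[R]_m) (a r : R).

Definition in_box (b : 'rV[R]_m * 'rV[R]_m) : set 'rV[R]_m :=
  [set x | forall j, `|x 0 j - b.1 0 j| <= b.2 0 j].

(* The volume of a box is measured by the product of its half-widths; all the
   volume estimates hold up to a factor depending on [m] only. *)
Definition covered E (a : R) := exists s : seq ('rV[R]_m * 'rV[R]_m),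
  [/\ forall b, b \in s -> forall j, 0 < b.2 0 j,
      forall x, E x -> exists2 b, b \in s & in_box b x &
      \sum_(b <- s) \prod_j b.2 0 j <= a].

Lemma covered_sub E F a (b : R) : covered F a -> E `<=` F -> a <= b -> covered E b.
Proof.
move=> [s [s0 sF sa]] EF ab; exists s; split=> // [x /EF/sF//|].
exact: le_trans sa ab.
Qed.

Lemma covered_bigcup (I : eqType) (s : seq I) (F : I -> set 'rV[R]_m) (a : I -> R) :
  (forall i, i \in s -> covered (F i) (a i)) ->
  covered (\bigcup_(i in [set` s]) F i) (\sum_(i <- s) a i).
Proof.
elim: s => [|i s IHs] cF.
  by exists [::]; rewrite !big_nil; split=> // x [].
have [t [t0 tF ta]] := cF i (mem_head _ _).
have [|t' [t0' tF' ta']] := IHs; first by move=> j js; apply: cF; rewrite inE js orbT.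
exists (t ++ t'); split=> [b|x [j /=]|].
- by rewrite mem_cat => /orP[/t0|/t0'].
- rewrite inE => /predU1P[->|js] Fx.
    by have [b bt bx] := tF _ Fx; exists b; rewrite // mem_cat bt.
  have [|b bt bx] := tF' x; first by exists j.
  by exists b; rewrite // mem_cat bt orbT.
- by rewrite big_cat big_cons lerD.
Qed.

(** Of the [N ^ m] grid points [c + r p / N] of the cube, a box contains at most [4 N b_j / r] in
    each direction [j]: its side is [2 b_j], and [card_grid_le] costs another factor 2. Summing over
    the boxes, [N ^ m] cancels. *)
Lemma cube_covered_ge c r a : 0 < r ->
  covered [set x | forall j, `|x 0 j - c 0 j| <= r] a -> r ^+ m <= 4 ^+ m * a.
Proof.
move=> r0 [s [s0 sE sa]].
(* The mesh [r / N] is at most every half-width, so the sides are long enough for [card_grid_le]. *)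
pose N := (\sum_(b <- s) \sum_j Num.truncn (r / b.2 0 j)%R).+1.
have N0 : 0 < N%:R :> R by rewrite ltr0n.
have NE b (j : 'I_m) : b \in s -> 1 <= b.2 0 j * N%:R / r.
  move=> bs; rewrite ler_pdivlMr// mul1r mulrC -ler_pdivrMr ?s0//.
  apply/ltW/(lt_le_trans (truncnS_gt _)); rewrite ler_nat ltnS.
  by rewrite (big_rem b)//= (bigD1 j)//= -addnA leq_addr.
pose P (b : 'rV[R]_m * 'rV[R]_m) : pred {ffun 'I_m -> 'I_N} := [pred p : {ffun 'I_m -> 'I_N} |
  [forall j, `|c 0 j + r * (p j)%:R / N%:R - b.1 0 j| <= b.2 0 j]].
have : (#|{: {ffun 'I_m -> 'I_N}}| <= \sum_(b <- s) #|P b|)%N.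
  apply: card_le_cover => p.
  have [|b bs pb] := sE (\row_j (c 0 j + r * (p j)%:R / N%:R)).
    move=> j; rewrite mxE addrAC subrr add0r ger0_norm; last first.
      by rewrite divr_ge0 ?mulr_ge0// ltW.
    by rewrite ler_pdivrMr// ler_wpM2l ?ltW// ltr_nat.
  by exists b => //; apply/forallP => j; have := pb j; rewrite mxE.
rewrite card_ffun !card_ord -(ler_nat R) natrX natr_sum => count.
have {}count : N%:R ^+ m <= \sum_(b <- s) \prod_(j < m) (4 * N%:R / r * b.2 0 j).
  apply: le_trans count _; rewrite big_seq [leRHS]big_seq; apply: ler_sum => b bs.
  rewrite (@card_fun_family m N (fun j => [pred q : 'I_N |
    `|c 0 j + r * q%:R / N%:R - b.1 0 j| <= b.2 0 j])) natr_prod.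
  apply: ler_prod => j _; rewrite ler0n /=.
  have b1 := NE b j bs.
  apply: (@le_trans _ _ (2 * (2 * (b.2 0 j * N%:R / r)))); last first.
    by rewrite le_eqVlt; apply/orP; left; apply/eqP; ring.
  apply: (@card_grid_le _ _ _ ((b.1 0 j - b.2 0 j - c 0 j) * (N%:R / r))).
    by lra.
  move=> q /=; rewrite ler_norml => /andP[q1 q2].
  have -> : q%:R = (r * q%:R / N%:R) * (N%:R / r) :> R.
    by field; rewrite !gt_eqF.
  have -> : 2 * (b.2 0 j * N%:R / r) = (2 * b.2 0 j) * (N%:R / r) by ring.
  by rewrite -mulrDl !ler_pM2r ?divr_gt0//; apply/andP; split; lra.
move: count; under eq_bigr do rewrite big_split prodr_const card_ord /=.
rewrite -mulr_sumr expr_div_n exprMn => count.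
apply: le_trans (_ : 4 ^+ m * (\sum_(b <- s) \prod_j b.2 0 j) <= _); last first.
  by rewrite ler_wpM2l// exprn_ge0.
rewrite -(ler_pM2r (exprn_gt0 m N0)) -ler_pdivlMl ?exprn_gt0//.
by apply: le_trans count _; rewrite le_eqVlt; apply/orP; left; apply/eqP; ring.
Qed.

(** For positive radii this is disjointness of the open balls with centres [p.1], [q.1] and radii
    [p.2], [q.2], which are cubes in the sup norm. *)
Definition balls_apart (p q : 'rV[R]_m * R) := p.2 + q.2 <= `|p.1 - q.1|.

(** A grid of mesh [2 rho / N] is laid over the cube of radius [rho]. Disjoint balls contain
    disjoint sets of grid points, and a ball of radius [p.2] has at least [N p.2 / (4 rho)] in each
    direction. *)
Lemma packing c (rho : R) (s : seq ('rV[R]_m * R)) : 0 < rho -> pairwise balls_apart s ->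
  (forall p, p \in s -> 0 < p.2) ->
  (forall p, p \in s -> `|p.1 - c| + p.2 <= rho) ->
  \sum_(p <- s) p.2 ^+ m <= (4 * rho) ^+ m.
Proof.
move=> rho0 ssep s0 sc.
(* Every radius is then at least twice the mesh, as [card_grid_ge] requires. *)
pose N := (\sum_(p <- s) Num.truncn (4 * rho / p.2)%R).+1.
have N0 : 0 < N%:R :> R by rewrite ltr0n.
have NE p : p \in s -> 2 <= p.2 * (N%:R / (2 * rho)).
  move=> ps; rewrite mulrA ler_pdivlMr ?mulr_gt0// mulrA mulrC.
  rewrite [p.2 * _]mulrC -ler_pdivrMr ?s0//.
  have -> : rho * (2 * 2) / p.2 = 4 * rho / p.2 by ring.
  apply/ltW/(lt_le_trans (truncnS_gt _)); rewrite ler_nat ltnS.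
  by rewrite (big_rem p)//= leq_addr.
(* [u] and [d] are the centre and the radius of a ball in grid units. *)
pose u (p : 'rV[R]_m * R) j := (p.1 0 j - c 0 j + rho) * (N%:R / (2 * rho)).
pose d (p : 'rV[R]_m * R) := p.2 * (N%:R / (2 * rho)).
pose P p : pred {ffun 'I_m -> 'I_N} := [pred f : {ffun 'I_m -> 'I_N} |
  [forall j, `|(f j)%:R - u p j| < d p]].
have NR0 : 0 < N%:R / (2 * rho) by rewrite divr_gt0 ?mulr_gt0.
have : (\sum_(p <- s) #|P p| <= #|{: {ffun 'I_m -> 'I_N}}|)%N.
  apply: card_ge_disjoint; apply: (@sub_in_pairwise _ (mem s) balls_apart) ssep; last exact/allP.
  move=> p q ps qs.
  rewrite /balls_apart => pq; apply/forallP => f; apply/negP => /andP[/forallP fp /forallP fq].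
  move: pq; apply/negP; rewrite -ltNge; apply/row_norm_ltP.
    by rewrite addr_gt0 ?s0.
  move=> j; have := fp j; have := fq j.
  rewrite !ltr_norml => /andP[f1 f2] /andP[f3 f4].
  have : `|u p j - u q j| < d p + d q by rewrite ltr_norml; apply/andP; split; lra.
  rewrite /u /d -mulrBl -mulrDl normrM (gtr0_norm NR0) ltr_pM2r// !mxE.
  by rewrite ltr_norml => /andP[g1 g2]; apply/andP; split; lra.
rewrite card_ffun !card_ord -(ler_nat R) natrX natr_sum => count.
have {}count : \sum_(p <- s) \prod_(j < m) (N%:R / (4 * rho) * p.2) <= N%:R ^+ m.
  apply: le_trans _ count; rewrite big_seq [leRHS]big_seq; apply: ler_sum => p ps.
  rewrite (@card_fun_family m N (fun j => [pred q : 'I_N | `|q%:R - u p j| < d p])) natr_prod.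
  apply: ler_prod => j _; apply/andP; split.
    by rewrite mulr_ge0 ?divr_ge0 ?ltW ?mulr_gt0 ?s0.
  have -> : N%:R / (4 * rho) * p.2 = d p / 2 by rewrite /d; field; rewrite gt_eqF.
  have pj : `|p.1 0 j - c 0 j| <= rho - p.2.
    have p0 : 0 <= rho - p.2 by rewrite (le_trans _ (_ : `|p.1 - c| <= _))// lerBrDr sc.
    have : `|p.1 - c| <= rho - p.2 by rewrite lerBrDr sc.
    by move/(row_norm_leP _ p0) => /(_ j); rewrite !mxE.
  move: pj; rewrite ler_norml => /andP[pj1 pj2].
  apply: card_grid_ge; rewrite ?NE//.
    by rewrite /u /d -mulrBl mulr_ge0 ?(ltW NR0)//; lra.
  rewrite /u /d -mulrDl mulrA ler_pdivrMr ?mulr_gt0// mulrC ler_wpM2l//; lra.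
move: count; under eq_bigr do rewrite big_split !prodr_const card_ord /=.
rewrite -mulr_sumr => count.
rewrite -(ler_pM2l (_ : 0 < (N%:R / (4 * rho)) ^+ m)); last first.
  by rewrite exprn_gt0// divr_gt0 ?mulr_gt0.
apply: (le_trans count); rewrite -exprMn divfK// gt_eqF// mulr_gt0//.
Qed.

Lemma interval_subdivision (K : nat) (t c w : R) : (0 < K)%N -> 0 < w -> `|t - c| <= w ->
  exists p : 'I_K, `|t - (c - w + (2 * p%:R + 1) * w / K%:R)| <= w / K%:R.
Proof.
move=> K0 w0; rewrite ler_norml => /andP[t1 t2].
have KR : 0 < K%:R :> R by rewrite ltr0n.
pose u := (t - c + w) * K%:R / (2 * w).
have u0 : 0 <= u by rewrite divr_ge0 ?mulr_ge0//; lra.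
have uK : u <= K%:R.
  by rewrite ler_pdivrMr ?mulr_gt0// mulrC ler_pM2l//; lra.
have [p /andP[p1 p2]] : exists p : 'I_K, p%:R <= u <= p%:R + 1.
  have [ut|ut] := ltP (Num.truncn u) K.
    exists (Ordinal ut) => /=; have /andP[-> /ltW] := truncn_itv u0.
    by rewrite natr1.
  (* Here [u = K], that is, [t] is the right endpoint; it belongs to the last part. *)
  have Kp : (K.-1 < K)%N by rewrite prednK.
  exists (Ordinal Kp) => /=; rewrite natr1 prednK// uK andbT.
  apply: le_trans (_ : K%:R <= u); first by rewrite ler_nat leq_pred.
  by rewrite -truncn_ge_nat.
exists p; have -> : t = c - w + u * (2 * w / K%:R).
  by rewrite /u; field; rewrite !gt_eqF.
have -> : c - w + u * (2 * w / K%:R) - (c - w + (2 * p%:R + 1) * w / K%:R) =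
          (2 * (u - p%:R) - 1) * (w / K%:R) by field; rewrite gt_eqF.
have wK : 0 < w / K%:R by rewrite divr_gt0.
rewrite normrM (gtr0_norm wK) ler_piMl ?(ltW wK)// ler_norml.
by apply/andP; split; lra.
Qed.

Definition volume_factor (A : 'M[R]_m) (kappa : R) := forall b : 'rV[R]_m * 'rV[R]_m,
  (forall j, 0 < b.2 0 j) ->
  covered ((mulmxr A) @` in_box b) (kappa * \prod_j b.2 0 j).

(* Coordinate [i] is cut into [N ^ nu i] parts; since [A i j != 0] forces
   [nu j < nu i], for large [N] the image of each piece is close to a box. *)
Lemma volume_factor_triangular (A : 'M[R]_m) (nu : 'I_m -> nat) :
  (forall i j, i != j -> A i j != 0 -> (nu j < nu i)%N) ->
  (forall j, A j j != 0) ->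
  volume_factor A (2 ^+ m * \prod_j `|A j j|).
Proof.
move=> Anu A0 [c w] /= w0.
(* [N] absorbs the sums of column entries in [NE]: after subdivision, the off-diagonal entries of
   column [j] contribute no more than the diagonal one. *)
pose N := (\sum_j Num.truncn ((\sum_i `|A i j| * w 0 i) / (`|A j j| * w 0 j))%R).+1.
have N0 : 0 < N%:R :> R by rewrite ltr0n.
have NE j : \sum_i `|A i j| * w 0 i <= N%:R * (`|A j j| * w 0 j).
  rewrite -ler_pdivrMr ?mulr_gt0 ?normr_gt0//.
  apply/ltW/(lt_le_trans (truncnS_gt _)); rewrite ler_nat ltnS.
  by rewrite [leqRHS](bigD1 j)//= leq_addr.
pose K j := (N ^ nu j)%N.
have K0 j : (0 < K j)%N by rewrite expn_gt0.
have KR0 j : 0 < (K j)%:R :> R by rewrite ltr0n.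
pose index := {dffun forall j : 'I_m, 'I_(K j)}.
pose center (p : index) := \row_j (c 0 j - w 0 j + (2 * (p j)%:R + 1) * w 0 j / (K j)%:R).
(* Half of this half-width is for the diagonal entry, half for the off-diagonal ones. There are as
   many pieces as the product of the [K j], so the [K j] cancel from the total volume. *)
pose W := \row_j (2 * `|A j j| * w 0 j / (K j)%:R).
have W0 j : 0 < W 0 j by rewrite mxE divr_gt0 ?mulr_gt0 ?normr_gt0.
exists [seq (center p *m A, W) | p : index]; split.
- by move=> _ /mapP[p _ ->].
- move=> _ [x xb <-].
  pose p j := cid (interval_subdivision (K0 j) (w0 j) (xb j)).
  pose q : index := [ffun j => projT1 (p j)].
  exists (center q *m A, W); first by apply/mapP; exists q; rewrite ?mem_enum.
  move=> j /=.
  have -> : (x *m A) 0 j - (center q *m A) 0 j =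
      \sum_i (x 0 i - center q 0 i) * A i j.
    by rewrite !mxE -sumrB; apply: eq_bigr => i _; rewrite mulrBl.
  rewrite (le_trans (ler_norm_sum _ _ _))//.
  apply: le_trans (_ : \sum_i w 0 i / (K i)%:R * `|A i j| <= _).
    apply: ler_sum => i _; rewrite normrM ler_wpM2r//.
    by have := projT2 (p i); rewrite mxE ffunE.
  rewrite (bigD1 j)//= mxE.
  apply: le_trans (_ : w 0 j / (K j)%:R * `|A j j| +
     \sum_(i | i != j) `|A i j| * w 0 i / (N%:R * (K j)%:R) <= _).
    rewrite lerD2l; apply: ler_sum => i ij.
    have [->|Aij] := eqVneq (A i j) 0; first by rewrite normr0 mulr0 !mul0r.
    rewrite mulrC mulrA ler_wpM2l ?mulr_ge0 ?(ltW (w0 i))//.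
    rewrite lef_pV2 ?posrE ?mulr_gt0// -natrM ler_nat -expnS leq_pexp2l//.
    exact: Anu.
  have : \sum_(i | i != j) `|A i j| * w 0 i / (N%:R * (K j)%:R) <=
       `|A j j| * w 0 j / (K j)%:R.
    rewrite -mulr_suml ler_pdivrMr ?mulr_gt0// mulrCA divfK ?gt_eqF//.
    apply: le_trans (NE j); rewrite [leRHS](bigD1 j)//= lerDr.
    by rewrite mulr_ge0// ltW.
  have -> : 2 * `|A j j| * w 0 j / (K j)%:R =
    w 0 j / (K j)%:R * `|A j j| + `|A j j| * w 0 j / (K j)%:R by ring.
  by rewrite lerD2l.
- rewrite big_image /= sumr_const card_dep_ffun foldrE big_image /=.
  rewrite [X in _ *+ X](_ : _ = \prod_j K j)%N; last by apply: eq_bigr => j _; exact: card_ord.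
  rewrite -[leLHS]mulr_natl natr_prod -big_split /=.
  rewrite -[X in _ ^+ X](card_ord m) -prodr_const -!big_split /=.
  rewrite le_eqVlt; apply/orP; left; apply/eqP; apply: eq_bigr => j _.
  by rewrite mxE; field; rewrite gt_eqF.
Qed.

End Covering.

(** * Volume distortion of invertible linear maps *)

Section VolumeFactor.
Variable R : realType.

Lemma volume_factor_mul m (A B : 'M[R]_m) kA kB : 0 <= kB ->
  volume_factor A kA -> volume_factor B kB -> volume_factor (A *m B) (kA * kB).
Proof.
move=> kB0 hA hB b b0; have [s [s0 sA sa]] := hA b b0.
have cB : forall b', b' \in s ->
    covered (mulmxr B @` in_box b') (kB * \prod_j b'.2 0 j).
  by move=> b' /s0; exact: hB.
apply: covered_sub (covered_bigcup cB) _ _.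
  move=> _ [x bx <-]; have [|b' b's b'x] := sA (x *m A); first by exists x.
  by exists b' => //; exists (x *m A) => //=; rewrite mulmxA.
by rewrite -mulr_sumr (mulrC kA) -mulrA ler_wpM2l.
Qed.

Lemma volume_factor_perm m (s : 'S_m) : volume_factor (perm_mx s : 'M[R]_m) 1.
Proof.
move=> [c w] /= w0.
exists [:: (col_perm s^-1 c, col_perm s^-1 w)]; split.
- by move=> _ /[!inE] /eqP -> j; rewrite mxE.
- move=> _ [x xb <-]; exists (col_perm s^-1 c, col_perm s^-1 w); first by rewrite inE.
  by move=> j /=; rewrite -{1}(invgK s) -col_permE !mxE.
- rewrite big_seq1 mul1r [leRHS](reindex_inj (@perm_inj _ s^-1)).
  by rewrite le_eqVlt; apply/orP; left; apply/eqP/eq_bigr => j _; rewrite mxE.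
Qed.

(** By the LUP decomposition: the permutation contributes 1 and each triangular factor contributes
    [2 ^ m.+1] times its diagonal. The order [nu] is [i] for the lower factor, whose diagonal is 1,
    and [m - i] for the upper one. *)
Lemma volume_factor_unit m (A : 'M[R]_m.+1) : A \in unitmx ->
  volume_factor A (4 ^+ m.+1 * `|\det A|).
Proof.
move=> Au; have := cormen_lup_correct A; have := cormen_lup_perm A.
have := cormen_lup_detL A; have := @cormen_lup_lower _ _ A; have := @cormen_lup_upper _ _ A.
case: cormen_lup => [[P L] U] /= Uup Llow detL /is_perm_mxP[s ->] PLU.
have detU : \det U = \prod_j U j j.
  rewrite -det_tr det_trig; first by apply: eq_bigr => j _; rewrite mxE.
  by apply/is_trig_mxP => i j ij; rewrite mxE Uup.
have detA : `|\det A| = \prod_j `|U j j|.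
  rewrite -normr_prod -detU -[in RHS](mul1r (\det U)) -detL -det_mulmx.
  rewrite -[L *m U]/(L * U) -PLU -[_ * A]/(_ *m A) det_mulmx det_perm normrM.
  by rewrite normr_sign mul1r.
have Ujj j : U j j != 0.
  move: Au; rewrite unitmxE unitfE -normr_eq0 detA => /prodf_neq0/(_ j isT).
  by rewrite normr_eq0.
have -> : A = perm_mx s^-1 *m (L *m U).
  by rewrite -[L *m U]/(L * U) -PLU -[_ * A]/(_ *m A) mulmxA -perm_mxM mulVg perm_mx1 mul1mx.
have -> : 4 ^+ m.+1 * `|\det (perm_mx s^-1 *m (L *m U))| =
   1 * ((2 ^+ m.+1 * \prod_j `|L j j|) * (2 ^+ m.+1 * \prod_j `|U j j|)).
  rewrite det_mulmx det_perm normrM normr_sign !mul1r det_mulmx detL mul1r detU.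
  have -> : \prod_j `|L j j| = 1 by rewrite big1// => j _; rewrite Llow// eqxx normr1.
  rewrite normr_prod mulr1 mulrA -exprMn; congr (_ ^+ _ * _); ring.
apply: volume_factor_mul; first by rewrite !mulr_ge0 ?exprn_ge0 ?prodr_ge0.
  exact: volume_factor_perm.
apply: volume_factor_mul; first by rewrite !mulr_ge0 ?exprn_ge0 ?prodr_ge0.
  apply: (volume_factor_triangular (nu := fun i => i)) => [i j ij|j].
    by rewrite ltnNge; apply: contra_neqN => ji; rewrite Llow// (negPf ij).
  by rewrite Llow// eqxx oner_eq0.
apply: (volume_factor_triangular (nu := fun i : 'I_m.+1 => (m - i)%N)) => // i j ij Uij.
have {}ij : (i < j)%N.
  by rewrite ltn_neqAle ij/= leqNgt; apply: contra_neqN Uij => /Uup.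
by rewrite ltn_sub2l// (leq_trans ij)// -ltnS.
Qed.

End VolumeFactor.

(** * Finite subcovers of compact sets *)

Section CompactCover.

(** Otherwise the complements in [E] of finite unions of the [V q] generate a proper filter. At a
    cluster point [p] of it, [V p] would meet its own complement. *)
Lemma compact_seq_cover (T : topologicalType) (E : set T) (V : T -> set T) :
  compact E -> (forall p, E p -> nbhs p (V p)) ->
  exists s : seq T, (forall p, p \in s -> E p) /\ E `<=` \bigcup_(p in [set` s]) V p.
Proof.
move=> Ec EV; apply: contrapT => /forallNP nocover.
pose good (s : seq T) := forall p, p \in s -> E p.
pose rest (s : seq T) := E `\` \bigcup_(p in [set` s]) V p.
pose F := filter_from good rest.
have FF : ProperFilter F.
  apply: filter_from_proper; first apply: filter_from_filter.
  - by exists [::].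
  - move=> s t gs gt; exists (s ++ t); first by move=> p; rewrite mem_cat => /orP[/gs|/gt].
    move=> p [Ep stp]; split; split=> // -[q /= qs Vq]; apply: stp;
      by exists q => //=; rewrite mem_cat qs ?orbT.
  - move=> s gs; apply: contrapT => /nonemptyPn rest0; apply: (nocover s); split=> //.
    by move=> p Ep; apply: contrapT => np; suff : rest s p by rewrite rest0.
have [|p [Ep clp]] := Ec F FF.
  by exists [::] => // p [].
have [||q [[_ nq] Vq]] := clp (rest [:: p]) (V p).
- by exists [:: p] => // q /[!inE] /eqP ->.
- exact: EV.
- by apply: nq; exists p => //=; rewrite inE.
Qed.

End CompactCover.

(** * Volume of images under differentiable maps *)

Section Vitali.
Variable R : realType.

(** Greedy choice: keep a ball [q0] of largest radius, drop those not apart from it, and recurse.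
    Positivity of the radius makes [q0] drop itself, so the list gets shorter. *)
Lemma vitali_selection m (s : seq ('rV[R]_m * R)) : (forall p, p \in s -> 0 < p.2) ->
  exists t : seq ('rV[R]_m * R), [/\ {subset t <= s}, pairwise (@balls_apart R m) t &
    forall p, p \in s -> exists2 q, q \in t & `|p.1 - q.1| < p.2 + q.2 /\ p.2 <= q.2].
Proof.
have [k] := ubnP (size s); elim: k s => // k IHk [|p0 s0] sk s_gt0.
  by exists [::]; split.
set s := p0 :: s0 in sk s_gt0 *.
have [q0 q0s q0max] : exists2 q0, q0 \in s & forall p, p \in s -> p.2 <= q0.2.
  rewrite /s; elim: s0 p0 {s sk s_gt0} => [|p1 s IHs] p0.
    by exists p0 => [|p]; rewrite ?inE// => /eqP ->.
  have [q qs qmax] := IHs p1; have [pq|qp] := leP p0.2 q.2.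
    exists q; first by rewrite inE qs orbT.
    by move=> p; rewrite inE => /predU1P[->//|]; exact: qmax.
  exists p0; first exact: mem_head.
  by move=> p; rewrite inE => /predU1P[->//|/qmax] pq; rewrite (le_trans pq)// ltW.
pose s' := [seq p <- s | balls_apart q0 p].
have [||t [ts tsep tP]] := IHk s'.
- rewrite -ltnS (leq_trans _ sk)// ltnS size_filter -(count_predC (balls_apart q0) s).
  rewrite -[ltnLHS]addn0 ltn_add2l -has_count; apply/hasP; exists q0 => //=.
  by rewrite -ltNge subrr normr0 addr_gt0 ?s_gt0.
- by move=> p; rewrite mem_filter => /andP[_ /s_gt0].
exists (q0 :: t); split.
- by move=> p; rewrite inE => /predU1P[->//|/ts]; rewrite mem_filter => /andP[].
- rewrite /= tsep andbT; apply/allP => p /ts; by rewrite mem_filter => /andP[].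
- move=> p ps; have [sep|] := boolP (balls_apart q0 p).
    have [|q qt pq] := tP p; first by rewrite mem_filter sep.
    by exists q => //; rewrite inE qt orbT.
  rewrite /balls_apart -ltNge => qp; exists q0; first exact: mem_head.
  by rewrite distrC [p.2 + _]addrC; split=> //; exact: q0max.
Qed.

(** Around each point take a ball of radius at most [rho] whose threefold dilate obeys the local
    estimate. Finitely many cover [E], and the dilates of a disjoint selection still do. The
    selected balls lie in the ball of radius [2 * rho], so [packing] yields [24 = 3 * (4 * 2)]. *)
Lemma vitali_covered m (T : topologicalType) (E : set T) (x f : T -> 'rV[R]_m)
    (delta : R) c (rho : R) :
  compact E -> (forall p, E p -> {for p, continuous x}) ->
  0 <= delta -> 0 < rho -> (forall p, E p -> `|x p - c| <= rho) ->
  (forall p, E p -> exists2 r0 : R, 0 < r0 & forall r, 0 < r < r0 ->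
    covered (f @` (E `&` [set q | `|x q - x p| <= r])) (delta * r ^+ m)) ->
  covered (f @` E) (delta * (24 * rho) ^+ m).
Proof.
move=> Ec xc delta0 rho0 Erho Ecov.
have /choice[r rP] : forall p, exists r : R, E p -> [/\ 0 < r, r <= rho &
    covered (f @` (E `&` [set q | `|x q - x p| <= 3 * r])) (delta * (3 * r) ^+ m)].
  move=> p; have [Ep|nEp] := pselect (E p); last by exists 0.
  have [r0 r00 rcov] := Ecov _ Ep; exists (Num.min (r0 / 4) rho) => _.
  have r40 : 0 < Num.min (r0 / 4) rho by rewrite lt_min rho0 divr_gt0.
  split=> //; first by rewrite ge_min lexx orbT.
  apply: rcov; rewrite mulr_gt0//=.
  apply: (@le_lt_trans _ _ (3 * (r0 / 4))); last by lra.
  by rewrite ler_pM2l// ge_min lexx.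
have [|s [sE scov]] := @compact_seq_cover T E (fun p => [set q | `|x q - x p| < r p]) Ec.
  move=> p Ep; have [rp _ _] := rP p Ep.
  have := xc p Ep; move/cvgr_dist_lt => /(_ _ rp); apply: filterS => q /=.
  by rewrite distrC.
pose s' := [seq (x p, r p) | p <- s].
have s'P q : q \in s' -> exists2 p, E p & q = (x p, r p).
  by move=> /mapP[p /sE Ep ->]; exists p.
have [|t [ts tsep tP]] := @vitali_selection m s'.
  by move=> q /s'P[p /rP[rp _ _] ->].
have tcov q : q \in t ->
    covered (f @` (E `&` [set p | `|x p - q.1| <= 3 * q.2])) (delta * (3 * q.2) ^+ m).
  by move=> /ts/s'P[p /rP[_ _ rp] ->].
apply: covered_sub (covered_bigcup tcov) _ _.
  move=> _ [p Ep <-]; have [q /= qs pq] := scov p Ep.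
  have [|q' q't [q'q rq]] := tP (x q, r q); first by apply/mapP; exists q.
  exists q' => //=; exists p => //; split=> //=.
  rewrite (le_trans (ler_distD (x q) _ _))//.
  by move: q'q rq pq => /=; lra.
rewrite -mulr_sumr ler_wpM2l//.
under eq_bigr do rewrite exprMn.
rewrite -mulr_sumr (_ : 24 * rho = 3 * (4 * (2 * rho))); last by ring.
rewrite exprMn ler_wpM2l ?exprn_ge0//; apply: (@packing _ _ c) => //.
- by rewrite mulr_gt0.
- by move=> p /ts/s'P[p' /rP[rp _ _] ->].
- move=> p /ts/s'P[p' Ep' ->] /=; have [_ rp _] := rP _ Ep'.
  by have := Erho _ Ep'; lra.
Qed.

(** Near [p] the error of the linear approximation, pulled back by [invmx J], is at most [r]. So the
    image lies in the image under [J] of a cube of half-width [2 * r], and [8 = 4 * 2]. The last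
    hypothesis turns closeness in coordinates into closeness in [T]; [chart_small] provides it for
    charts. *)
Lemma jacobian_covered m (T : topologicalType) (E : set T) (x f : T -> 'rV[R]_m.+1)
    p (J : 'M[R]_m.+1) :
  is_jacobian x f p J -> J \in unitmx ->
  (forall N, nbhs p N -> exists2 r0 : R, 0 < r0 &
     forall q, E q -> `|x q - x p| <= r0 -> N q) ->
  exists2 r0 : R, 0 < r0 & forall r, 0 < r < r0 ->
    covered (f @` (E `&` [set q | `|x q - x p| <= r])) (8 ^+ m.+1 * `|\det J| * r ^+ m.+1).
Proof.
move=> xJ Ju Esmall; have [B B0 hB] := mulmx_norm_bound (invmx J).
have Bi0 : 0 < B^-1 by rewrite invr_gt0.
have [r0 r00 Er0] := Esmall _ (xJ _ Bi0); exists r0 => // r /andP[r_gt0 rr0].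
pose b : 'rV[R]_m.+1 * 'rV[R]_m.+1 := (f p *m invmx J, const_mx (2 * r)).
have r20 : 0 <= 2 * r by rewrite mulr_ge0// ltW.
have b0 j : 0 < b.2 0 j by rewrite mxE mulr_gt0.
apply: covered_sub (volume_factor_unit Ju b0) _ _.
  move=> _ [q [Eq /= qr] <-]; exists (f q *m invmx J); last by rewrite /= mulmxKV.
  have {}Er0 := Er0 q Eq (le_trans qr (ltW rr0)).
  suff bound : `|f q *m invmx J - f p *m invmx J| <= 2 * r.
    by move=> j /=; move/(row_norm_leP _ r20)/(_ j) : bound; rewrite !mxE.
  rewrite -mulmxBl -[f q - f p](subrK ((x q - x p) *m J)) mulmxDl mulmxK//.
  rewrite (le_trans (ler_normD _ _))// mulr_natl mulr2n.
  rewrite lerD// (le_trans (hB _))// mulrC -ler_pdivlMr// mulrC.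
  by rewrite (le_trans Er0)// ler_pM2l.
under eq_bigr do rewrite mxE.
rewrite prodr_const card_ord exprMn.
rewrite (_ : 8 = 4 * 2); last by ring.
by rewrite exprMn le_eqVlt; apply/orP; left; apply/eqP; ring.
Qed.

Lemma chart_small m (T : topologicalType) (D : set T) (x : T -> 'rV[R]_m) p N :
  is_chart D x -> D p -> nbhs p N ->
  exists2 r0 : R, 0 < r0 & forall q, D q -> `|x q - x p| <= r0 -> N q.
Proof.
move=> [oD xc xi xD] Dp Np.
have [W' oW' xDW] := xD D oD (@subset_refl _ _).
have [||W oW xW] := xD (interior N `&` D).
- by apply: openI => //; exact: open_interior.
- by move=> q [].
have : (W `&` @half_space R m) (x p) by rewrite -xW; exists p.
move=> [Wp _]; have /nbhs_ballP[r /= r0 rW] : nbhs (x p) W by exact: open_nbhs_nbhs.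
exists (r / 2) => [|q Dq qr]; first exact: divr_gt0.
have [_ Hq] : (W' `&` @half_space R m) (x q) by rewrite -xDW; exists q.
have : (W `&` @half_space R m) (x q).
  split=> //; apply: rW; rewrite -ball_normE /= distrC (le_lt_trans qr)//.
  by rewrite ltr_pdivrMr// ltr_pMr// ltr1n.
rewrite -xW => -[q' [Nq' Dq'] xq'].
have <- : q' = q by apply: xi; rewrite ?inE.
exact: interior_subset.
Qed.

End Vitali.

(** * Jacobians and the inverse function theorem *)

Section Jacobian.
Variable R : realType.

Lemma smooth_at_jacobian m (T : topologicalType) (x : T -> 'rV[R]_m) p
    (f : T -> 'rV[R]_m) :
  {for p, continuous x} -> smooth_at x p f -> exists J, is_jacobian x f p J.
Proof.
move=> xc [U [G [[oU Up] sG fG]]].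
have [dG _] := sG 1%N; have {dG} := dG _ Up.
set D := 'd G (x p) => dG.
exists (lin1_mx D) => e e0.
have Ge : \forall z \near x p, `|G z - G (x p) - (z - x p) *m lin1_mx D| <= e * `|z - x p|.
  have /eqaddoP/(_ e e0) := diff_locally dG.
  rewrite !near_simpl /= => He.
  have : \forall z \near x p, `|G ((z - x p) + x p) - (G (x p) + D (z - x p))| <= e * `|z - x p|.
    have zx : z - x p @[z --> x p] --> (0 : 'rV[R]_m).
      by rewrite -[X in _ --> X](subrr (x p)); exact: (cvgB (@cvg_id _ _) (cvg_cst _)).
    exact: zx _ He.
  by apply: filterS => z; rewrite subrK mul_rV_lin1 opprD addrA.
have fp := nbhs_singleton fG.
near=> q; have -> : f q = G (x q) by near: q.
by rewrite fp; near: q; exact: xc _ Ge.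
Unshelve. all: by end_near. Qed.

Lemma is_jacobian_le m (T : topologicalType) (x f : T -> 'rV[R]_m) p J :
  is_jacobian x f p J ->
  exists2 B, 0 < B & \forall q \near p, `|f q - f p| <= B * `|x q - x p|.
Proof.
move=> xJ; have [B B0 hB] := mulmx_norm_bound J.
exists (1 + B); first by rewrite addr_gt0.
have := xJ 1 ltr01; apply: filterS => q hq.
rewrite -(subrK ((x q - x p) *m J) (f q - f p)) mulrDl.
by rewrite (le_trans (ler_normD _ _))// lerD.
Qed.

Lemma is_jacobian_continuous m (T : topologicalType) (x f : T -> 'rV[R]_m) p J :
  {for p, continuous x} -> is_jacobian x f p J -> {for p, continuous f}.
Proof.
move=> xc /is_jacobian_le[B B0 hB]; apply/cvgrPdist_lt => e e0.
near=> q; rewrite distrC (@le_lt_trans _ _ (B * `|x q - x p|))//; first by near: q.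
rewrite -ltr_pdivlMl// distrC; near: q.
by apply: (cvgr_dist_lt _ _ xc); rewrite mulr_gt0 ?invr_gt0.
Unshelve. all: by end_near. Qed.

Lemma is_jacobian_comp m (T T' : topologicalType) (phi : T -> T')
    (x : T -> 'rV[R]_m) (y z : T' -> 'rV[R]_m) p J J' :
  {for p, continuous phi} ->
  is_jacobian x (y \o phi) p J -> is_jacobian y z (phi p) J' ->
  is_jacobian x (z \o phi) p (J *m J').
Proof.
move=> phic xJ yJ e e0.
have [B B0 hB] := is_jacobian_le xJ.
have [B' B'0 hB'] := mulmx_norm_bound J'.
have e1 : 0 < e / 2 / B' by rewrite !divr_gt0.
have e2 : 0 < e / 2 / B by rewrite !divr_gt0.
have zphi := phic _ (yJ _ e2).
near=> q.
have h1 : `|y (phi q) - y (phi p) - (x q - x p) *m J| <= e / 2 / B' * `|x q - x p|.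
  by near: q; exact: xJ.
have h2 : `|z (phi q) - z (phi p) - (y (phi q) - y (phi p)) *m J'| <=
  e / 2 / B * `|y (phi q) - y (phi p)| by near: q.
have h3 : `|y (phi q) - y (phi p)| <= B * `|x q - x p| by near: q.
have -> : (z \o phi) q - (z \o phi) p - (x q - x p) *m (J *m J') =
  (z (phi q) - z (phi p) - (y (phi q) - y (phi p)) *m J') +
  (y (phi q) - y (phi p) - (x q - x p) *m J) *m J'.
  by rewrite /= [X in _ = _ + X]mulmxBl mulmxA addrA subrK.
rewrite (le_trans (ler_normD _ _))// [e]splitr mulrDl lerD//.
  have -> : e / 2 * `|x q - x p| = e / 2 / B * (B * `|x q - x p|).
    by field; rewrite gt_eqF.
  by rewrite (le_trans h2)// ler_wpM2l// ltW.
rewrite (le_trans (hB' _))// mulrC -ler_pdivlMr//.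
by rewrite (le_trans h1)// le_eqVlt; apply/orP; left; apply/eqP; ring.
Unshelve. all: by end_near. Qed.

(** Differentiability of [phi] is recovered from that of [z \o phi], as for a map defined by solving
    an equation. The increment [dy] equals [dz *m invmx G] up to an error of at most half its norm;
    absorbing it gives [dyK], and then all errors are small relative to [dx]. *)
Lemma is_jacobian_div m (T T' : topologicalType) (phi : T -> T')
    (x : T -> 'rV[R]_m) (y z : T' -> 'rV[R]_m) p F G :
  {for p, continuous phi} -> G \in unitmx ->
  is_jacobian x (z \o phi) p F -> is_jacobian y z (phi p) G ->
  is_jacobian x (y \o phi) p (F *m invmx G).
Proof.
move=> phic Gu xF yG e e0.
have [BF BF0 hF] := is_jacobian_le xF.
have [B B0 hB] := mulmx_norm_bound (invmx G).
pose K := 2 * B * BF.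
have K0 : 0 < K by rewrite !mulr_gt0.
have e1 : 0 < e / 2 / B by rewrite !divr_gt0.
have e2 : 0 < Num.min (2 * B)^-1 (e / 2 / B / K).
  by rewrite lt_min invr_gt0 mulr_gt0//= !divr_gt0.
have yphi := phic _ (yG _ e2).
near=> q.
have h1 : `|z (phi q) - z (phi p) - (x q - x p) *m F| <= e / 2 / B * `|x q - x p|.
  by near: q; exact: xF.
have h2 : `|z (phi q) - z (phi p) - (y (phi q) - y (phi p)) *m G| <=
  Num.min (2 * B)^-1 (e / 2 / B / K) * `|y (phi q) - y (phi p)| by near: q.
have h3 : `|z (phi q) - z (phi p)| <= BF * `|x q - x p| by near: q.
rewrite /=; move: h1 h2 h3.
move: (x q - x p) (y _ - y _) (z _ - z _) => dx dy dz h1 h2 h3.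
have dyE : dy = dz *m invmx G - (dz - dy *m G) *m invmx G.
  by rewrite mulmxBl mulmxK// opprB addrC subrK.
have dyK : `|dy| <= K * `|dx|.
  have : `|dy| <= B * `|dz| + B * ((2 * B)^-1 * `|dy|).
    rewrite {1}dyE (le_trans (ler_normB _ _))// lerD// (le_trans (hB _))//.
    rewrite ler_wpM2l ?(ltW B0)// (le_trans h2)// ler_wpM2r// ge_min lexx//.
  have -> : B * ((2 * B)^-1 * `|dy|) = `|dy| / 2 by field; rewrite gt_eqF.
  move=> dyle; have {dyle} : `|dy| <= 2 * (B * `|dz|) by lra.
  move/le_trans; apply; rewrite /K -!mulrA ler_wpM2l// ler_wpM2l// ltW//.
have -> : dy - dx *m (F *m invmx G) =
    (dz - dx *m F) *m invmx G - (dz - dy *m G) *m invmx G.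
  by rewrite {1}dyE (mulmxBl dz (dx *m F)) mulmxA addrAC.
rewrite (le_trans (ler_normB _ _))// [e]splitr mulrDl lerD//.
  rewrite (le_trans (hB _))// mulrC -ler_pdivlMr//.
  by rewrite (le_trans h1)// le_eqVlt; apply/orP; left; apply/eqP; ring.
rewrite (le_trans (hB _))// mulrC -ler_pdivlMr// (le_trans h2)//.
apply: (@le_trans _ _ (e / 2 / B / K * (K * `|dx|))).
  by rewrite ler_pM// ?(ltW e2)// ge_min lexx orbT.
by rewrite le_eqVlt; apply/orP; left; apply/eqP; field; rewrite !gt_eqF.
Unshelve. all: by end_near. Qed.

(* For [y] close to [h x0], a minimiser of [|h z - y|] over a small closed ball
   is interior, and there moving along [- (h z - y) *m invmx J] would decrease
   the norm unless [h z = y]. *)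
Lemma jacobian_open m (h : 'rV[R]_m -> 'rV[R]_m) x0 (r0 : R) : 0 < r0 ->
  (forall z, `|z - x0| < r0 -> exists2 J, J \in unitmx & is_jacobian id h z J) ->
  nbhs (h x0) (h @` [set z | `|z - x0| < r0]).
Proof.
move=> r00 hJ.
have [|J0 J0u J0h] := hJ x0; first by rewrite subrr normr0.
have [B B0 hB] := mulmx_norm_bound (invmx J0).
have eB : 0 < (2 * B)^-1 by rewrite invr_gt0 mulr_gt0.
have /nbhs_ballP[r1 /= r10 hr1] := J0h _ eB.
pose rho := Num.min r0 r1 / 2.
have minr : 0 < Num.min r0 r1 by rewrite lt_min r00.
have rho0 : 0 < rho by rewrite divr_gt0.
have rhor0 : rho < r0.
  by rewrite /rho ltr_pdivrMr// (le_lt_trans (_ : _ <= r0)) ?ge_min ?lexx// ltr_pMr// ltr1n.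
have rhor1 : rho < r1.
  by rewrite /rho ltr_pdivrMr// (le_lt_trans (_ : _ <= r1)) ?ge_min ?lexx ?orbT// ltr_pMr// ltr1n.
(* On the sphere of radius [rho] the linear part has norm at least [rho / B = 2 * d] and the error
   is at most [d], so [h] stays at least [d] from [h x0]. For [y] within [d / 2] of [h x0], no
   minimiser lies on the sphere. *)
pose d := rho / (2 * B).
have d0 : 0 < d by rewrite divr_gt0// mulr_gt0.
have sphere z : `|z - x0| = rho -> d <= `|h z - h x0|.
  move=> zrho; have : `|h z - h x0 - (z - x0) *m J0| <= (2 * B)^-1 * `|z - x0|.
    by apply: hr1; rewrite -ball_normE /= distrC zrho.
  rewrite zrho mulrC -/d => h1.
  have : `|z - x0| <= B * `|(z - x0) *m J0|.
    by have := hB ((z - x0) *m J0); rewrite mulmxK.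
  rewrite zrho -ler_pdivrMl// mulrC => h2.
  have := ler_distD (h z - h x0) 0 ((z - x0) *m J0).
  rewrite !sub0r !normrN.
  have dB : rho / B = d * 2 by rewrite /d; field; rewrite gt_eqF.
  by rewrite dB in h2; lra.
apply/nbhs_ballP; exists (d / 2) => /= [|y]; first exact: divr_gt0.
rewrite -ball_normE /= => hy.
pose K := [set z : 'rV[R]_m | `|z - x0| <= rho].
have Kc : compact K.
  have -> : K = closed_ball x0 rho.
    by rewrite closed_ballE//; apply/seteqP; split=> z; rewrite /K /closed_ball_ /= distrC.
  apply: bounded_closed_compact; last exact: closed_ball_closed.
  exists (`|x0| + rho); split; first exact: num_real.
  move=> M x0M z; rewrite closed_ballE// /closed_ball_ /= distrC => zrho.
  rewrite -(subrK x0 z) (le_trans (ler_normD _ _))// (le_trans _ (ltW x0M))//.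
  by rewrite addrC lerD2l.
have K0 : K !=set0 by exists x0; rewrite /K /= subrr normr0 ltW.
have [|z Kz zmin] := @compact_EVT_min _ _ (fun z => `|h z - y|) K K0 Kc.
  apply: continuous_in_subspaceT => z /set_mem Kz.
  have [|J _ Jh] := hJ z; first exact: le_lt_trans Kz rhor0.
  have hc : {for z, continuous h} := is_jacobian_continuous (@cvg_id _ _) Jh.
  exact: cvg_norm (cvgB hc (cvg_cst y)).
move: Kz; rewrite inE => Kz.
have hx0y : `|h z - y| <= `|h x0 - y|.
  by apply: zmin; rewrite inE /K /= subrr normr0 ltW.
have {Kz} zrho : `|z - x0| < rho.
  rewrite lt_neqAle Kz andbT; apply/eqP => /sphere dz.
  have := ler_distD y (h z) (h x0); rewrite (distrC y).
  by lra.
have zr0 := lt_trans zrho rhor0.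
exists z => //.
have [J Ju Jh] := hJ z zr0.
apply: contrapT => /eqP; rewrite -subr_eq0 => v0.
set v := h z - y in v0 *.
have v_gt0 : 0 < `|v| by rewrite normr_gt0.
pose u := v *m invmx J.
have [Bu Bu0 hBu] := mulmx_norm_bound (invmx J).
have Bv : 0 < Bu * `|v| by rewrite mulr_gt0.
have e0 : 0 < (2 * Bu)^-1 by rewrite invr_gt0 mulr_gt0.
have near_z : \forall z' \near z, `|z' - x0| < rho /\
    `|h z' - h z - (z' - z) *m J| <= (2 * Bu)^-1 * `|z' - z|.
  near=> z'; split; last by near: z'; exact: Jh.
  rewrite (le_lt_trans (ler_distD z _ _))// -ltrBrDr distrC; near: z'.
  by apply: (@cvgr_dist_lt _ _ _ (nbhs z) _ id z (@cvg_id _ _)); rewrite subr_gt0.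
have /nbhs_ballP[s /= s0 hs] := near_z.
(* The step [- t *: u] stays where the linear approximation is valid. It turns [v] into
   [(1 - t) *: v] with an error of at most [t * |v| / 2], so the norm drops. *)
pose t := Num.min 1 (s / (2 * (Bu * `|v|))).
have t0 : 0 < t by rewrite lt_min ltr01/= divr_gt0// mulr_gt0.
have t1 : t <= 1 by rewrite ge_min lexx.
have uv : `|u| <= Bu * `|v| := hBu v.
have tu : `|t *: u| < s.
  rewrite normrZ (gtr0_norm t0) (@le_lt_trans _ _ (t * (Bu * `|v|)))//.
    by rewrite ler_wpM2l// ltW.
  rewrite -ltr_pdivlMr// (@le_lt_trans _ _ (s / (2 * (Bu * `|v|))))//.
    by rewrite ge_min lexx orbT.
  by rewrite invfM mulrA ltr_pM2r ?invr_gt0// ltr_pdivrMr// ltr_pMr// ltr1n.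
have [|z'rho hz'] := hs (z - t *: u).
  by rewrite -ball_normE /= opprB addrC subrK.
have : `|v| <= `|h (z - t *: u) - y| by apply: zmin; rewrite inE /K /= ltW.
apply/negP; rewrite -ltNge.
move: hz'; rewrite [z - _ - z]addrAC subrr add0r normrN mulNmx opprK.
rewrite -scalemxAl mulmxKV// => hz'.
have -> : h (z - t *: u) - y = (h (z - t *: u) - h z + t *: v) + (1 - t) *: v.
  by rewrite scalerBl scale1r addrACA subrr addr0 /v addrA subrK.
rewrite (le_lt_trans (ler_normD _ _))// [`|(1 - t) *: v|]normrZ ger0_norm ?subr_ge0//.
have tu2 : (2 * Bu)^-1 * `|t *: u| <= t * `|v| / 2.
  rewrite normrZ (gtr0_norm t0) mulrCA -mulrA ler_wpM2l ?(ltW t0)//.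
  rewrite -ler_pdivlMl// invrK; apply: (le_trans uv).
  by rewrite le_eqVlt; apply/orP; left; apply/eqP; field.
have tv : 0 < t * `|v| by rewrite mulr_gt0.
have aux (a b e g : R) : 0 < b -> a <= e -> e <= b / 2 -> a + (g - b) < g by lra.
by rewrite mulrBl mul1r; exact: aux tv hz' tu2.
Unshelve. all: by end_near. Qed.

End Jacobian.

(** * Volume densities on closed manifolds *)

Section Manifolds.
Variable R : realType.

Lemma coord_continuous_at m (M : manifold R m) (i : chart M) p :
  dom i p -> {for p, continuous (coord i)}.
Proof. by move=> ip; have [_ + _ _] := coord_chart i; apply; rewrite inE. Qed.

Lemma dom_nbhs m (M : manifold R m) (i : chart M) p : dom i p -> nbhs p (dom i).
Proof. by move=> ip; have [oD _ _ _] := coord_chart i; exact: open_nbhs_nbhs. Qed.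

(** Off the boundary the first coordinate is positive, so the half-space is itself a neighbourhood
    of [coord i p], and relatively open images become neighbourhoods in the whole space. *)
Lemma chart_image_nbhs m (M : manifold R m) (i : chart M) p N :
  @boundary R m M = set0 -> dom i p -> nbhs p N ->
  nbhs (coord i p) (coord i @` (N `&` dom i)).
Proof.
move=> M0 ip Np; have [oD _ _ xD] := coord_chart i.
have [||W oW xW] := xD (interior N `&` dom i).
- by apply: openI => //; exact: open_interior.
- by move=> q [].
have [Wp Hp] : (W `&` @half_space R m) (coord i p) by rewrite -xW; exists p.
have Hn (j : 'I_m) :
    nbhs (coord i p) [set z : 'rV[R]_m | val j = 0%N -> 0 <= z 0 j].
  have [j0|j0] := pselect (val j = 0%N); last first.
    by apply: (@filterE _ (nbhs (coord i p))) => z /j0.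
  have pj : 0 < coord i p 0 j.
    rewrite lt_neqAle Hp// andbT eq_sym; apply/eqP => pj0.
    by have : @boundary R m M p; [exists i, j|rewrite M0].
  have := @coord_continuous _ _ _ (0 : 'I_1) j (coord i p).
  move=> /(cvgr_gt (coord i p 0 j)) /(_ 0 pj).
  by apply: filterS => z /ltW z0 _.
have WH : nbhs (coord i p) (W `&` @half_space R m).
  by apply: filterI; [exact: open_nbhs_nbhs|exact: (@filter_forall _ _ _ (nbhs (coord i p)) _ Hn)].
apply: filterS WH => z; rewrite -xW => -[q [Nq Dq] <-].
by exists q => //; split=> //; exact: interior_subset.
Qed.

(** [jacobian_open] applies to [f] read in charts. The map [xi'] is the inverse of the chart on a
    ball, with arbitrary values elsewhere. *)
Lemma immersion_open m (M X : manifold R m) (f : M -> X) :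
  @boundary R m M = set0 -> continuous f ->
  (forall i j p, dom i p -> dom j (f p) ->
    exists2 J, J \in unitmx & is_jacobian (coord i) (coord j \o f) p J) ->
  open (range f).
Proof.
move=> M0 fc fJ; rewrite openE => _ [p _ <-].
have [i ip] := dom_cover p; have [j jp] := dom_cover (f p).
have [_ _ xi _] := coord_chart i; have [_ _ yi _] := coord_chart j.
have Np : nbhs p (f @^-1` dom j) by exact: fc _ (dom_nbhs jp).
have /nbhs_ballP[r0 /= r00 hr0] := chart_image_nbhs M0 ip Np.
have ball_img z : `|z - coord i p| < r0 ->
    exists q, [/\ dom j (f q), dom i q & coord i q = z].
  move=> zr; have [|q [jq iq] <-] := hr0 z; first by rewrite -ball_normE /= distrC.
  by exists q.
have /choice[xi' xi'P] : forall z, exists q, `|z - coord i p| < r0 ->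
    [/\ dom j (f q), dom i q & coord i q = z].
  move=> z; have [/ball_img[q qP]|nz] := pselect (`|z - coord i p| < r0); first by exists q.
  by exists p.
have xi'K q : dom i q -> `|coord i q - coord i p| < r0 -> xi' (coord i q) = q.
  by move=> iq /xi'P[_ iq' xq]; apply: xi; rewrite ?inE.
pose h := coord j \o f \o xi'.
have hp : h (coord i p) = coord j (f p).
  by rewrite /h /= xi'K// subrr normr0.
have := @jacobian_open R m h (coord i p) r0 r00; rewrite hp => hopen.
have {hopen}hopen : nbhs (coord j (f p)) (h @` [set z | `|z - coord i p| < r0]).
  apply: hopen => z zr; have [jz iz xz] := xi'P z zr.
  have [J Ju fqJ] := fJ _ _ _ iz jz; exists J => // e e0.
  have := chart_image_nbhs M0 iz (fqJ e e0); rewrite xz => hN.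
  have zball : \forall z' \near z, `|z' - coord i p| < r0.
    have : nbhs z (ball (coord i p) r0).
      by apply: open_nbhs_nbhs; split; [exact: ball_open|rewrite -ball_normE /= distrC].
    by rewrite -ball_normE; apply: filterS => z' /=; rewrite distrC.
  apply: filterS2 hN zball => _ [q [qN iq] <-] qr.
  have hq : h (coord i q) = coord j (f q) by rewrite /h /= xi'K.
  by rewrite /= hq; exact: qN.
have jN : nbhs (f p) (coord j @^-1` (h @` [set z | `|z - coord i p| < r0])).
  exact: coord_continuous_at jp _ hopen.
rewrite /interior /=; apply: filterS2 jN (dom_nbhs jp) => b [z zr hz] jb.
have [jz iz xz] := xi'P z zr.
by exists (xi' z) => //; apply: yi; rewrite ?inE.
Qed.

(** [W] gives the coefficient of a top-degree form in each chart; the last clause is the equation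
    [phi^* W = lambda W]. *)
Definition density_scaling m (M : manifold R m) (W : chart M -> M -> R) (lambda : R)
    (phi : M -> M) :=
  [/\ continuous phi, range phi = setT &
      forall i j p, dom i p -> dom j (phi p) -> exists2 J,
        is_jacobian (coord i) (coord j \o phi) p J &
        W j (phi p) * \det J = lambda * W i p].

Lemma density_scaling_comp m (M : manifold R m) (W : chart M -> M -> R) a b phi psi :
  density_scaling W a phi -> density_scaling W b psi ->
  density_scaling W (b * a) (psi \o phi).
Proof.
move=> [phic phis phiJ] [psic psis psiJ]; split.
- by move=> p; apply: continuous_comp; [exact: phic|exact: psic].
- apply/seteqP; split=> // r _; have [q _ <-] : range psi r by rewrite psis.
  have [p _ <-] : range phi q by rewrite phis.
  by exists p.
- move=> i j p ip jp; have [l lp] := dom_cover (phi p).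
  have [J pJ WJ] := phiJ _ _ _ ip lp; have [J' pJ' WJ'] := psiJ _ _ _ lp jp.
  exists (J *m J'); first exact: is_jacobian_comp (phic p) pJ pJ'.
  by rewrite det_mulmx mulrCA /= WJ' mulrCA [\det J * _]mulrC WJ mulrA.
Qed.

(* A surjection multiplying a volume density by a small factor would map a
   finite cover of [M] onto a set too small to contain a fixed coordinate cube. *)
Lemma no_volume_contraction m (M : manifold R m) (W : chart M -> M -> R) :
  (0 < m)%N -> closed_manifold M -> [set: M] !=set0 ->
  (forall i p, dom i p -> {for p, continuous (W i)}) ->
  (forall i p, dom i p -> W i p != 0) ->
  exists2 C, 0 < C & forall (phi : M -> M) lambda, 0 < lambda ->
    density_scaling W lambda phi -> C <= lambda.
Proof.
case: m M W => // m M W _ [Mc M0] [p1 _] Wc W0.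
have Mh := @space_hausdorff _ _ M.
have /choice[ch chP] := @dom_cover _ _ M.
(* On [good p] the coordinates stay in a unit ball and the density changes by a factor of at most 2.
   The two factors 2, at the source and at the target, give the 4 in [A]. *)
pose good p := [set q | [/\ dom (ch p) q, `|coord (ch p) q - coord (ch p) p| < 1,
   `|W (ch p) q| < 2 * `|W (ch p) p| & `|W (ch p) p| / 2 < `|W (ch p) q|]].
have Wp0 p : 0 < `|W (ch p) p| by rewrite normr_gt0 W0.
have good_nbhs p : nbhs p (good p).
  have h1 := dom_nbhs (chP p).
  have h2 : \forall q \near p, `|coord (ch p) p - coord (ch p) q| < 1.
    by apply: (@cvgr_dist_lt _ _ _ (nbhs p) _ (coord (ch p))) => //; exact: coord_continuous_at.
  have Wn : `|W (ch p) q| @[q --> p] --> `|W (ch p) p|.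
    by apply: cvg_norm; exact: Wc.
  have h3 : \forall q \near p, `|W (ch p) q| < 2 * `|W (ch p) p|.
    by apply: (cvgr_lt _ Wn); rewrite ltr_pMl// ltr1n.
  have h4 : \forall q \near p, `|W (ch p) p| / 2 < `|W (ch p) q|.
    by apply: (cvgr_gt _ Wn); rewrite ltr_pdivrMr// ltr_pMr// ltr1n.
  by near=> q; split; [near: q|rewrite distrC; near: q|near: q|near: q].
(* Closed neighbourhoods make the sets [E p] below compact. *)
have /choice[K KP] : forall p, exists K, [/\ nbhs p K, closed K & K `<=` good p].
  move=> p; have [N Np Ng] := compact_regular Mh Mc (@filterT _ _ (nbhs_filter p)) (good_nbhs p).
  exists (closure N); split=> //; last exact: closed_closure.
  by apply: filterS Np; exact: subset_closure.
have [|s [_ sK]] := @compact_seq_cover _ _ K Mc; first by move=> p _; have [] := KP p.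
have [K1n K1c K1g] := KP p1.
have /nbhs_ballP[rho /= rho0 hrho] := chart_image_nbhs M0 (chP p1) K1n.
pose r := rho / 2; have r0 : 0 < r by rewrite divr_gt0.
(* [A] depends on neither [phi] nor [lambda]. The images of the pieces cover a cube of radius [r],
   which forces [r ^+ m.+1 <= lambda * A]; adding 1 keeps the denominator positive. *)
pose A := 4 ^+ m.+1 *
  \sum_(p <- s) (8 ^+ m.+1 * (4 * `|W (ch p) p| / `|W (ch p1) p1|) * (24 * 1) ^+ m.+1).
have A0 : 0 <= A.
  apply: mulr_ge0; first exact: exprn_ge0.
  by apply: sumr_ge0 => p _; rewrite !mulr_ge0 ?exprn_ge0 ?invr_ge0 ?mulr_ge0.
exists (r ^+ m.+1 / (1 + A)).
  by rewrite divr_gt0 ?exprn_gt0// ltr_pwDl.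
move=> phi lambda l_gt0 [phic phis phiJ].
have l0 := ltW l_gt0; have ln0 := lt0r_neq0 l_gt0.
rewrite ler_pdivrMr; last by rewrite ltr_pwDl.
apply: (@le_trans _ _ (lambda * A)); last by rewrite mulrDr lerDr mulr1.
have lA : lambda * A = 4 ^+ m.+1 * \sum_(p <- s)
    (8 ^+ m.+1 * (lambda * (4 * `|W (ch p) p| / `|W (ch p1) p1|)) * (24 * 1) ^+ m.+1).
  rewrite /A [LHS]mulrCA; congr (_ * _); rewrite mulr_sumr; apply: eq_bigr => p _; ring.
rewrite lA; apply: (@cube_covered_ge R _ (coord (ch p1) p1)) => //.
pose f := coord (ch p1) \o phi.
pose E p := K p `&` phi @^-1` (K p1).
have cov p : p \in s -> covered (f @` E p)
    (8 ^+ m.+1 * (lambda * (4 * `|W (ch p) p| / `|W (ch p1) p1|)) * (24 * 1) ^+ m.+1).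
  move=> ps; have [Kn Kc Kg] := KP p.
  have Ec : compact (E p).
    apply: subclosed_compact (_ : closed (E p)) Mc _ => //.
    by apply: closedI => //; move/continuous_closedP: phic; exact.
  apply: (@vitali_covered _ _ _ _ (coord (ch p)) f _ (coord (ch p) p) 1) => //.
  - by move=> q [/Kg[dq _ _ _] _]; exact: coord_continuous_at.
  - by rewrite !mulr_ge0 ?exprn_ge0// invr_ge0.
  - by move=> q [/Kg[_ /ltW qp _ _] _].
  move=> q [Kq K1q]; have [dq _ Wq _] := Kg _ Kq; have [dq1 _ _ W1q] := K1g _ K1q.
  have [J qJ WJ] := phiJ _ _ _ dq dq1.
  have Ju : J \in unitmx.
    rewrite unitmxE unitfE; apply/eqP => J0; move/eqP: WJ; rewrite J0 mulr0 eq_sym.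
    by rewrite mulf_eq0 (negPf ln0) (negPf (W0 _ _ dq)).
  have [N Nq|r1 r10 hr1] := @jacobian_covered R m _ (E p) _ _ q J qJ Ju.
    have [r1 r10 hr1] := chart_small (coord_chart (ch p)) dq Nq.
    by exists r1 => // q' [/Kg[dq' _ _ _] _]; exact: hr1.
  exists r1 => // r' hr'; apply: covered_sub (hr1 r' hr') _ _ => //.
  have r'0 : 0 <= r' by case/andP: hr' => /ltW.
  rewrite ler_wpM2r ?exprn_ge0// ler_wpM2l ?exprn_ge0//.
  have W1 : 0 < `|W (ch p1) (phi q)| by rewrite normr_gt0 W0.
  have : `|W (ch p1) (phi q)| * `|\det J| = lambda * `|W (ch p) q|.
    by rewrite -normrM WJ normrM ger0_norm.
  move=> WJn; rewrite mulrA ler_pdivlMr//.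
  apply: (@le_trans _ _ (2 * (`|W (ch p1) (phi q)| * `|\det J|))).
    rewrite mulrA mulrC ler_wpM2r//; lra.
  rewrite WJn mulrCA ler_wpM2l//; lra.
apply: covered_sub (covered_bigcup cov) _ (lexx _).
move=> z zr; have [|q [K1q dq] <-] := hrho z.
  rewrite -ball_normE /= distrC (@le_lt_trans _ _ r)//.
    by apply/row_norm_leP; [exact: ltW|move=> j; rewrite !mxE].
  by rewrite /r ltr_pdivrMr// ltr_pMr// ltr1n.
(* Surjectivity of [phi] puts every point of the cube in the image of some piece. *)
have [q' _ q'q] : range phi q by rewrite phis.
have [p /= ps Kpq'] := sK q' I.
exists p => //; exists q'; last by rewrite /f /= q'q.
by split=> //; rewrite /= q'q.
Unshelve. all: by end_near. Qed.

End Manifolds.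

(** * Embeddings of rescaled copies *)

Section Density.
Variable R : realType.

Lemma smooth_at_continuous m (V : normedModType R) (T : topologicalType)
    (x : T -> 'rV[R]_m) p (f : T -> V) :
  {for p, continuous x} -> smooth_at x p f -> {for p, continuous f}.
Proof.
move=> xc [U [G [[oU Up] sG fG]]].
have Gc : {for x p, continuous G} by apply: (sG 0%N); rewrite inE.
have fp : f p = G (x p) := nbhs_singleton fG.
have : f q @[q --> p] --> G (x p); last by rewrite -fp.
apply: cvg_trans (near_eq_cvg (_ : {near p, G \o x =1 f})) _.
  by apply: filterS fG => q ->.
exact: continuous_comp xc Gc.
Qed.

Lemma wedge_pow_continuous (T : topologicalType) k m n (u : T -> 'M[R]_(k, m) -> R) p :
  (forall A, {for p, continuous (u ^~ A)}) ->
  forall A, {for p, continuous (fun q => wedge_pow n (u q) A)}.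
Proof.
move=> uc; elim: n => [|n IHn] A /=; first exact: cvg_cst.
rewrite /wedge; apply: cvgM; first exact: cvg_cst.
elim: (index_enum _) => [|s r IHr].
  by under eq_fun do rewrite big_nil; rewrite /continuous_at big_nil; exact: cvg_cst.
under eq_fun do rewrite big_cons; rewrite /continuous_at big_cons.
apply: cvgD; last exact: IHr.
by apply: cvgM; [apply: cvgM; [exact: cvg_cst|exact: uc]|exact: IHn].
Qed.

Variables (k n : nat).
Hypothesis n_gt0 : (0 < n)%N.

(** The coefficient of the n-th wedge power of [w] in chart [i]: its value on the standard basis,
    cast from [k * n] to [n * k] rows. *)
Definition density (M : manifold R (k * n)) (w : diff_form k M) (i : chart M) (p : M) : R :=
  wedge_pow n (coef w i p) (castmx (erefl, mulnC n k) 1%:M).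

Lemma density_continuous (M : manifold R (k * n)) (w : diff_form k M) i p :
  dom i p -> {for p, continuous (density w i)}.
Proof.
move=> ip; apply: wedge_pow_continuous => A.
exact: smooth_at_continuous (coord_continuous_at ip) (coef_smooth w A ip).
Qed.

Lemma coef_multilinear (M : manifold R (k * n)) (w : diff_form k M) i p :
  row_multilinear (coef w i p).
Proof. exact/alternating_multilinear/coef_alt. Qed.

Lemma wedge_pow_antisym (u : 'M[R]_(k, k * n) -> R) : row_antisymmetric (wedge_pow n u).
Proof. by case: n n_gt0 u => // n' _ u; exact: wedge_pow_antisymmetric. Qed.

Lemma density_neq0 (M : manifold R (k * n)) (w : diff_form k M) i p :
  maxipotent n w -> dom i p -> density w i p != 0.
Proof.
move=> wn ip; have [A] := wn i p ip; apply: top_form_neq0.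
  exact/wedge_pow_multilinear/coef_multilinear.
exact: wedge_pow_antisym.
Qed.

(** Wedge powers commute with pullback and turn the factor [s] into [s ^+ n]; in top degree,
    pullback by [J] is multiplication by its determinant. *)
Lemma density_pullback (M X : manifold R (k * n)) (w : diff_form k M)
    (w' : diff_form k X) i j p q J s :
  (forall A, coef w' j q (A *m J) = s * coef w i p A) ->
  \det J * density w' j q = s ^+ n * density w i p.
Proof.
move=> wJ; rewrite /density -wedge_pow_scale -(wedge_pow_mulmx (v := fun A => s * coef w i p A) wJ).
rewrite top_form_mulmx//; first exact: mulnC.
  exact/wedge_pow_multilinear/coef_multilinear.
exact: wedge_pow_antisym.
Qed.

End Density.

(** * Embeddings that rescale the form *)

Section Similarity.
Variables (R : realType) (m k : nat).

(** A topological embedding with [f^* Omega = s omega]. Differentiability is recorded as an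
    invertible Jacobian in each pair of charts, and the rescalings of source and target are merged
    into the one ratio [s]. *)
Definition similarity (M X : form_obj R m k) (s : R) (f : M -> X) :=
  [/\ continuous f, injective f,
      forall U : set M, open U -> exists2 V : set X, open V & U = f @^-1` V &
      forall i j p, dom i p -> dom j (f p) -> exists J,
        [/\ J \in unitmx, is_jacobian (coord i) (coord j \o f) p J &
            forall A, coef (obj_form X) j (f p) (A *m J) = s * coef (obj_form M) i p A]].

(** A summand is open in the disjoint union and its charts are charts of the union, so Jacobians and
    forms restrict unchanged. *)
Lemma similarity_summand (I : countType) (Z : I -> form_obj R m k) (X : form_obj R m k)
    (F : FormObj (sum_form (fun b => obj_form (Z b))) -> X) b :
  form_mor (FormObj (sum_form (fun b => obj_form (Z b)))) X F ->
  similarity (M := Z b) 1 (fun p => F (existT _ b p)).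
Proof.
move=> [[[[Fc Fs] Fim] Finj Fopen] Fpull]; split.
- move=> p; apply: continuous_comp; last exact: Fc.
  exact: existT_continuous.
- by move=> p q /Finj; exact: existT_inj2.
- move=> U oU; have [|V oV UV] := Fopen (existT _ b @` U); first exact: existT_open_map.
  exists V => //; apply/seteqP; split=> p.
    move=> Up; suff : (F @^-1` V) (existT _ b p) by []; by rewrite -UV; exists p.
  move=> Vp; have {Vp} : (F @^-1` V) (existT _ b p) by [].
  by rewrite -UV => -[q Uq qp]; rewrite -(existT_inj2 qp).
- move=> i j p ip jp.
  pose i' : chart (sum_manifold (fun b => obj_manifold (Z b))) := existT _ b i.
  have ip' : dom i' (existT _ b p) by exists p.
  have [J FJ] := smooth_at_jacobian (coord_continuous_at ip') (Fs _ _ _ ip' jp).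
  exists J; split.
  + by rewrite -row_free_unit; exact: Fim FJ.
  + move=> e e0; apply: filterS (existT_near (FJ e e0)) => q.
    by rewrite /= !untagT.
  + by move=> A; rewrite (Fpull _ _ _ _ _ ip' jp FJ) mul1r /= untagT.
Qed.

Lemma similarity_scale (M X : form_obj R m k) a t (f : M -> X) : t != 0 ->
  similarity (M := scale a M) (X := scale t X) 1 f -> similarity (M := M) (X := X) (a / t) f.
Proof.
move=> t0 [fc fi fo fJ]; split=> // i j p ip jp.
have [J [Ju pJ JA]] := fJ i j p ip jp; exists J; split=> // A.
have := JA A; rewrite /= mul1r => h.
by apply: (mulfI t0); rewrite h mulrA mulrCA mulfV// mulr1.
Qed.

Lemma similarity_open (M X : form_obj R m k) s (f : M -> X) :
  closed_manifold M -> similarity s f -> open (range f).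
Proof.
move=> [_ M0] [fc _ _ fJ]; apply: (immersion_open M0 fc) => i j p ip jp.
by have [J [Ju pJ _]] := fJ i j p ip jp; exists J.
Qed.

Lemma similarity_closed (M X : form_obj R m k) s (f : M -> X) :
  closed_manifold M -> similarity s f -> closed (range f).
Proof.
move=> [Mc _] [fc _ _ _]; apply: compact_closed; first exact: space_hausdorff.
by apply: continuous_compact => //; exact: continuous_subspaceT.
Qed.

(** The range of [g] is open and closed, so it contains the connected range of [f] once they
    meet. *)
Lemma similarity_range (M X : form_obj R m k) s s' (f g : M -> X) :
  closed_manifold M -> connected [set: M] -> similarity s f -> similarity s' g ->
  range f `&` range g !=set0 -> range f `<=` range g.
Proof.
move=> Mc Mconn fs gs fg0.
have fconn : connected (range f).
  apply: connected_continuous_connected => //; apply: continuous_subspaceT.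
  by case: fs.
have <- : range f `&` range g = range f.
  apply: fconn => //; exists (range g) => //.
    exact: similarity_open gs.
  exact: similarity_closed gs.
by move=> p [].
Qed.

End Similarity.

(** * Countability of the ratios *)

Section Main.
Variables (R : realType) (k n : nat).
Hypotheses (k_gt0 : (0 < k)%N) (n_gt0 : (0 < n)%N).
Variable M : form_obj R (k * n) k.
Hypotheses (M_nonempty : [set: M] !=set0) (M_closed : closed_manifold M)
  (M_connected : connected [set: M]) (M_maxipotent : maxipotent n (obj_form M)).
Variable X : form_obj R (k * n) k.

(** The map is [phi], the composite of [f] with the inverse of [g]. It is continuous because [g] is
    a topological embedding, and its Jacobian comes from [is_jacobian_div]. *)
Lemma similarity_transition s s' (f g : M -> X) : 0 < s -> 0 < s' ->
  similarity (X := X) s f -> similarity (X := X) s' g -> range f = range g ->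
  exists phi : M -> M, density_scaling (density (obj_form M)) ((s / s') ^+ n) phi.
Proof.
move=> s0 s'0 [fc fi fo fJ] [gc gi go gJ] fg.
have /choice[phi phiP] : forall p, exists q, g q = f p.
  move=> p; have [q _ gq] : range g (f p) by rewrite -fg; exists p.
  by exists q.
have phic : continuous phi.
  apply/continuousP => U /go[V oV ->].
  have -> : phi @^-1` (g @^-1` V) = f @^-1` V.
    by apply/seteqP; split=> p /=; rewrite phiP.
  by move/continuousP: fc; exact.
exists phi; split=> //.
  apply/seteqP; split=> // q _; have [p _ fp] : range f (g q) by rewrite fg; exists q.
  by exists p => //; apply: gi; rewrite phiP.
move=> i j p ip jp; have [l lp] := dom_cover (f p).
have [F [Fu pF fF]] := fJ _ _ _ ip lp.
have lp' : dom l (g (phi p)) by rewrite phiP.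
have [G [Gu pG gG]] := gJ _ _ _ jp lp'.
exists (F *m invmx G).
  apply: (is_jacobian_div (z := coord l \o g)) => //; first exact: phic.
  by move=> e e0; have := pF e e0; apply: filterS => q /=; rewrite !phiP.
have := density_pullback n_gt0 fF; have := density_pullback n_gt0 gG; rewrite phiP.
(* [D] is the coefficient on [X] at the common image point. After multiplication by [s' ^+ n], both
   sides of the goal equal [\det F * D]. *)
set D := density _ l _ => hG hF.
rewrite det_mulmx det_inv; move: Gu Fu; rewrite !unitmxE !unitfE => detG detF.
have s'n : s' ^+ n != 0 by rewrite expf_neq0// gt_eqF.
apply: (mulfI s'n); rewrite expr_div_n [RHS]mulrA [s' ^+ n * (_ / _)]mulrC divfK// -hF.
by rewrite [LHS]mulrA -hG; field.
Qed.

Lemma similarity_ratio_eq s s' (f g : M -> X) : 0 < s -> 0 < s' ->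
  similarity (X := X) s f -> similarity (X := X) s' g ->
  range f `&` range g !=set0 -> s = s'.
Proof.
wlog ss' : s s' f g / s < s' => [hwlog s0 s'0 fs gs fg|s0 s'0 fs gs fg].
  have [ss'|s's|//] := ltgtP s s'; first exact: (hwlog s s' f g).
  by apply/esym; apply: (hwlog s' s g f) => //; rewrite setIC.
have fgE : range f = range g.
  apply/seteqP; split; first exact: similarity_range fs gs fg.
  by apply: similarity_range gs fs _ => //; rewrite setIC.
have [phi phiS] := similarity_transition s0 s'0 fs gs fgE.
set lambda := _ ^+ n in phiS.
have l0 : 0 < lambda by rewrite exprn_gt0// divr_gt0.
have l1 : lambda < 1.
  by rewrite exprn_ilt1 ?ltW ?divr_gt0// -?lt0n// ltr_pdivrMr// mul1r.
have kn : (0 < k * n)%N by rewrite muln_gt0 k_gt0.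
have [C C0 hC] := no_volume_contraction kn M_closed M_nonempty
  (@density_continuous R k n M (obj_form M))
  (fun i p => density_neq0 n_gt0 M_maxipotent).
have phiN N : density_scaling (density (obj_form M)) (lambda ^+ N.+1) (iter N.+1 phi).
  elim: N => [|N IHN]; first by [].
  by rewrite exprS; exact: density_scaling_comp IHN phiS.
have nl : `|lambda| < 1 by rewrite gtr0_norm.
(* Powers of [lambda] fall below the bound [C], which every iterate of [phi] must respect. *)
have [N _ /(_ N.+1)] := cvg_expr nl (nbhs_lt C0).
rewrite /= leqnSn => /(_ isT) /(_ (ltW (exprn_gt0 _ l0))).
by rewrite ltNge (hC _ _ (exprn_gt0 _ l0) (phiN N)).
Qed.

(** To each ratio attach a nonempty member of a countable basis inside the open image of an
    embedding. Equal members make two images meet, hence the ratios agree. *)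
Lemma countable_ratios :
  countable [set s | 0 < s /\ exists f : M -> X, similarity (X := X) s f].
Proof.
have [p0 _] := M_nonempty.
have [B Bc [Bo Bb]] := @space_second_countable _ _ X.
have /countable_injP[g ginj] := Bc.
set S := [set s | _].
have /choice[U UP] : forall s, exists U : set X, S s ->
    [/\ B U, U !=set0 & exists2 f : M -> X, similarity (X := X) s f & U `<=` range f].
  move=> s; have [[s0 [f fs]]|] := pselect (S s); last by exists set0.
  have fN : nbhs (f p0) (range f).
    by apply: open_nbhs_nbhs; split; [exact: similarity_open fs|exists p0].
  have [U [BU Up] Uf] := Bb _ _ fN.
  by exists U => _; split=> //; [exists (f p0)|exists f].
apply/countable_injP; exists (g \o U) => s s' /set_mem Ss /set_mem Ss' /= gU.
have [BU [q Uq] [f fs Uf]] := UP s Ss; have [BU' _ [f' fs' Uf']] := UP s' Ss'.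
have UU' : U s = U s' by apply: ginj; rewrite ?inE.
apply: (similarity_ratio_eq Ss.1 Ss'.1 fs fs').
by exists q; split; [exact: Uf|apply: Uf'; rewrite -UU'].
Qed.

End Main.

(** The unit interval has Lebesgue measure 1, whereas countable sets have measure 0. *)
Lemma uncountable_positive (R : realType) : ~ countable [set x : R | 0 < x].
Proof.
move=> c; have : countable (`]0, 1[%classic : set R).
  by apply: sub_countable c; apply: subset_card_le => x /=; rewrite in_itv /= => /andP[].
move/countable_lebesgue_measure0; rewrite lebesgue_measure_itv /= lte_fin ltr01.
by rewrite oppr0 adde0 => /eqP; rewrite eqe oner_eq0.
Qed.

Theorem proposition12 (R : realType) (k n : nat) (hk : (0 < k)%N) (hn : (0 < n)%N)
    (M : form_obj R (k * n) k)
    (M_nonempty : [set: M] !=set0)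
    (M_closed : closed_manifold M)
    (M_connected : connected [set: M])
    (M_maxipotent : maxipotent n (obj_form M))
    (C : weak_form_category R (k * n) k)
    (c : form_obj R (k * n) k -> \bar R)
    (c_capacity : is_capacity C c)
    (C_unions : forall a b : R, 0 < a -> 0 < b ->
      objs C (disjoint_union (scale a M) (scale b M)))
    (c_finite : forall a b : R, 0 < a -> 0 < b ->
      (c (disjoint_union (scale a M) (scale b M)) < +oo)%E) :
  ~ target_representable C c.
Proof.
move=> [X cX].
pose S := [set s : R | 0 < s /\ exists f : M -> X, similarity (X := X) s f].
have Sc : countable S by exact: countable_ratios.
apply: (@uncountable_positive R).
apply: sub_countable (countableX Sc Sc).
apply: card_le_trans (card_image_le (fun q => q.1 / q.2) _).
apply: subset_card_le => a /= a0.
(* Finiteness on the union of [a M] and [1 M] yields an embedding into some [t X]. Its summands have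
   ratios [a / t] and [1 / t], whose quotient is [a]. *)
have := c_finite a 1 a0 ltr01; rewrite cX; last exact: C_unions.
move=> /ereal_inf_lt[_ [t [t0 [F Fmor]] <-] _].
have t_neq0 : t != 0 by rewrite gt_eqF.
pose Z (b : bool) := if b then scale 1 M else scale a M.
have summand b := @similarity_summand R (k * n) k _ Z _ F b Fmor.
exists (a / t, 1 / t); last by rewrite /=; field.
split; (split; first by rewrite divr_gt0).
  by exists (fun p => F (existT _ false p)); exact: similarity_scale t_neq0 (summand false).
by exists (fun p => F (existT _ true p)); exact: similarity_scale t_neq0 (summand true).
Qed.
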